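(* Let $A\in\mathbb{C}^{n\times n}$, $b\in\mathbb{C}^n$, and let $F(s)=\mathcal{L}\{f\}(s)$ be the Laplace transform of a function $f$. Assume that $$\nu=\min_{\mu\in W(A)}\operatorname{Re}(\mu)$$ lies within the region of absolute convergence of $\mathcal{L}\{f\}(s)$. Consider the restarted Arnoldi method for $F(A)b$ with restart length $m$, with Hessenberg matrices $H_m^{(j)}$, scalars $h_{m+1,m}^{(j)}$, vectors $v_{m+1}^{(j)}$ and iterates $f_m^{(j)}$ in cycle $j$. Define $f^{(1)}=f$, $$g^{(j)}(\tau)=e_m^{\mathsf T}\exp(-\tau H_m^{(j)})e_1\quad (j\ge 1),\qquad f^{(j)}(t)=\int_0^\infty f^{(j-1)}(t+\tau)\,g^{(j-1)}(\tau)\,\mathrm{d}\tau\quad (j\ge 2).$$ Then for every $k\ge 1$ the error $\varepsilon_m^{(k)}=F(A)b-f_m^{(k)}$ after $k$ restart cycles satisfies $$\varepsilon_m^{(k)}=(-1)^k\Big(\prod_{j=1}^k h_{m+1,m}^{(j)}\Big)\|b\|_2\,\mathcal{L}\{f^{(k+1)}\}(A)\,v_{m+1}^{(k)}.$$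
   Context: Arnoldi process: for $A\in\mathbb{C}^{n\times n}$ and a nonzero starting vector $c\in\mathbb{C}^n$, the $m$-step Arnoldi process (assumed to run without breakdown) computes a nested orthonormal basis $v_1,\dots,v_m$ of the Krylov space $\operatorname{span}\{c,Ac,\dots,A^{m-1}c\}$ with $v_1=c/\|c\|_2$, a further unit vector $v_{m+1}$ orthogonal to $v_1,\dots,v_m$, an upper Hessenberg matrix $H_m=V_m^{\mathsf H}AV_m\in\mathbb{C}^{m\times m}$, where $V_m=[v_1\mid\dots\mid v_m]$, and a scalar $h_{m+1,m}$, satisfying $AV_m=V_mH_m+h_{m+1,m}v_{m+1}e_m^{\mathsf T}$. Here $e_1,e_m\in\mathbb{C}^m$ are the first and $m$th canonical unit vectors. Restarted Arnoldi method (restart length $m$): cycle $1$ applies the $m$-step Arnoldi process to $A$ and $b\ne 0$; cycle $k\ge 2$ applies it to $A$ and the unit vector $v_{m+1}^{(k-1)}$ obtained at the end of cycle $k-1$. The quantities of cycle $k$ are denoted $V_m^{(k)},H_m^{(k)},h_{m+1,m}^{(k)},v_{m+1}^{(k)}$, so $AV_m^{(k)}=V_m^{(k)}H_m^{(k)}+h_{m+1,m}^{(k)}v_{m+1}^{(k)}e_m^{\mathsf T}$. The iterates are $f_m^{(1)}=\|b\|_2V_m^{(1)}F(H_m^{(1)})e_1$ and, for $k\ge 2$, $f_m^{(k)}=f_m^{(k-1)}+d_m^{(k-1)}$, where $d_m^{(k-1)}$ is the $m$-step Arnoldi approximation to the error $\varepsilon_m^{(k-1)}=F(A)b-f_m^{(k-1)}$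 of the previous cycle; explicitly, with the functions $f^{(k)}$ defined in the claim, $$d_m^{(k-1)}=(-1)^{k-1}\Big(\prod_{j=1}^{k-1}h_{m+1,m}^{(j)}\Big)\|b\|_2\,V_m^{(k)}\,\mathcal{L}\{f^{(k)}\}(H_m^{(k)})\,e_1 .$$ (All quantities are understood in exact arithmetic, with exact integrals.) Laplace transform: $\mathcal{L}\{f\}(s)=\int_0^\infty f(t)\exp(-st)\,\mathrm{d}t$. Its region of absolute convergence is the set of all $s\in\mathbb{C}$ for which this integral converges absolutely. For a square matrix $M$, $\mathcal{L}\{f\}(M)=\int_0^\infty f(t)\exp(-tM)\,\mathrm{d}t$, and $F(M)=\mathcal{L}\{f\}(M)$ if $F=\mathcal{L}\{f\}$. Field of values: $W(A)=\{x^{\mathsf H}Ax:\ x\in\mathbb{C}^n,\ \|x\|_2=1\}$.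
   Formalization: If ν is on the boundary of the region of absolute convergence, the integrals L{f^(j)}(H^(j)) for 2≤j≤k and L{f^(j)}(A) for 2≤j≤k+1 may diverge; their absolute convergence is assumed there. It is proved if the transform converges absolutely at some σ<ν. *)

(* Defs.v *)
From HB Require Import structures.
From mathcomp Require Import all_boot all_order all_algebra.
From mathcomp Require Import complex.
From mathcomp Require Import all_classical all_reals all_analysis.
Set Implicit Arguments.
Unset Strict Implicit.
Unset Printing Implicit Defensive.
Import Order.TTheory GRing.Theory Num.Theory.
Import numFieldNormedType.Exports.
Local Open Scope classical_set_scope.
Local Open Scope complex_scope.
Local Open Scope sesquilinear_scope.
Local Open Scope ring_scope.

Section Defs.
Variable R : realType.
Local Notation C := R[i].

Definition half_line : set R := `[0, +oo[%classic.

(* A complex integral over [0, +oo[ converges absolutely iff the real and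
   imaginary parts of the integrand are Lebesgue integrable there. *)
Definition cintegrable (u : R -> C) : Prop :=
  (@lebesgue_measure R).-integrable half_line (EFin \o (fun t => complex.Re (u t)))
  /\ (@lebesgue_measure R).-integrable half_line (EFin \o (fun t => complex.Im (u t))).

Definition cintegral (u : R -> C) : C :=
  (\int[@lebesgue_measure R]_(t in half_line) complex.Re (u t))%R
  +i* (\int[@lebesgue_measure R]_(t in half_line) complex.Im (u t))%R.

Definition cexp (z : C) : C :=
  (expR (complex.Re z))%:C * (cos (complex.Im z) +i* sin (complex.Im z)).

Definition climn (u : nat -> C) : C :=
  (limn (fun N => complex.Re (u N))) +i* (limn (fun N => complex.Im (u N))).

Definition expmx n (M : 'M[C]_n) : 'M[C]_n :=
  \matrix_(i, j) climn (fun N => (\sum_(k < N) (k`!%:R)^-1 *: M ^+ k) i j).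

Definition abs_conv_region (f : R -> C) : set C :=
  [set s | cintegrable (fun t => f t * cexp (- s * t%:C))].

(* L{f}(M), which is also F(M) for F = L{f}. *)
Definition laplace_mx (f : R -> C) n (M : 'M[C]_n) : 'M[C]_n :=
  \matrix_(i, j) cintegral (fun t => f t * expmx (- t%:C *: M) i j).

Definition laplace_mx_cvg (f : R -> C) n (M : 'M[C]_n) : Prop :=
  forall i j, cintegrable (fun t => f t * expmx (- t%:C *: M) i j).

Definition norm2 n (x : 'cV[C]_n) : C := sqrtC (\sum_i `|x i 0| ^+ 2).

Definition field_of_values n (A : 'M[C]_n) : set C :=
  [set mu | exists2 x : 'cV[C]_n, norm2 x = 1 & mu = (x ^t* *m A *m x) 0 0].

Definition is_min (E : set R) (x : R) : Prop := E x /\ lbound E x.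

(* The restart length, which is at least 1, is written m.+1 throughout. *)
Definition e_first m : 'cV[C]_m.+1 := delta_mx ord0 0.
Definition e_last m : 'cV[C]_m.+1 := delta_mx ord_max 0.

(* Result of m.+1 Arnoldi steps from c. The process breaks down at step i when
   h_(i+1,i) = 0. For i <= m this is excluded by arnoldi_orthonormal together
   with arnoldi_krylov, for the last step by arnoldi_no_breakdown. *)
Record arnoldi n m (A : 'M[C]_n) (c : 'cV[C]_n) (V : 'M[C]_(n, m.+1))
    (H : 'M[C]_m.+1) (h : C) (v : 'cV[C]_n) : Prop := Arnoldi {
  arnoldi_start : c != 0;
  arnoldi_orthonormal : V ^t* *m V = 1%:M;
  arnoldi_krylov : forall j, (j <= m.+1)%N ->
    (<<[seq col i V | i : 'I_m.+1 <- enum 'I_m.+1 & (i < j)%N]>>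
     = <<[seq A ^+ l *m c | l <- iota 0 j]>>)%VS;
  arnoldi_first : col ord0 V = (norm2 c)^-1 *: c;
  arnoldi_unit : norm2 v = 1;
  arnoldi_orthogonal : V ^t* *m v = 0;
  arnoldi_H : H = V ^t* *m A *m V;
  arnoldi_hessenberg : forall i j : 'I_m.+1, (j.+1 < i)%N -> H i j = 0;
  arnoldi_no_breakdown : h != 0;
  arnoldi_relation : A *m V = V *m H + h *: (v *m (e_last m)^T)
}.

(* Cycles are numbered from 1: V k, H k, h k and v k belong to cycle k, and
   their values at k = 0 are irrelevant. *)
Definition cycle_start n (b : 'cV[C]_n) (v : nat -> 'cV[C]_n) (k : nat) :=
  if (k <= 1)%N then b else v k.-1.

Definition restarted_arnoldi n m (A : 'M[C]_n) (b : 'cV[C]_n)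
    (V : nat -> 'M[C]_(n, m.+1)) (H : nat -> 'M[C]_m.+1) (h : nat -> C)
    (v : nat -> 'cV[C]_n) (k : nat) : Prop :=
  forall j, (1 <= j <= k)%N ->
    arnoldi A (cycle_start b v j) (V j) (H j) (h j) (v j).

Definition restart_kernel m (H : 'M[C]_m.+1) (tau : R) : C :=
  ((e_last m)^T *m expmx (- tau%:C *: H) *m e_first m) 0 0.

(* f^(j), for j >= 1 *)
Fixpoint restart_fun m (f : R -> C) (H : nat -> 'M[C]_m.+1) (j : nat) : R -> C :=
  if j is j'.+1 then
    if j' is 0%N then f
    else fun t => cintegral (fun tau =>
           restart_fun f H j' (t + tau) * restart_kernel (H j') tau)
  else f.

(* d_m^(k), the correction computed in cycle k.+1, for k >= 1 *)
Definition correction n m (f : R -> C) (b : 'cV[C]_n)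
    (V : nat -> 'M[C]_(n, m.+1)) (H : nat -> 'M[C]_m.+1) (h : nat -> C)
    (k : nat) : 'cV[C]_n :=
  ((-1) ^+ k * (\prod_(1 <= j < k.+1) h j) * norm2 b) *:
    (V k.+1 *m laplace_mx (restart_fun f H k.+1) (H k.+1) *m e_first m).

(* f_m^(k), for k >= 1 *)
Fixpoint iterate n m (f : R -> C) (b : 'cV[C]_n)
    (V : nat -> 'M[C]_(n, m.+1)) (H : nat -> 'M[C]_m.+1) (h : nat -> C)
    (k : nat) : 'cV[C]_n :=
  if k is k'.+1 then
    if k' is 0%N then norm2 b *: (V 1%N *m laplace_mx f (H 1%N) *m e_first m)
    else iterate f b V H h k' + correction f b V H h k'
  else 0.

(* Existence of the integrals in the error formulas of cycles 1, ..., k.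
   Those of L{f^(1)} are omitted, since they exist as soon as nu is in the
   region of absolute convergence of L{f}. The integral defining f^(j)(t),
   t >= 0, converges as soon as the one defining L{f^(j-1)}(H_m^(j-1)) does.

   Membership of nu in the region does not imply this if nu is on the boundary:
   for A = [0 -1; 1 0], m = 1 (restart length), b = e_1 one has nu = 0,
   H_m^(1) = 0 and g^(1) = 1, and f(t) = 1 / ((t + 2) ln(t + 2)^2) gives
   f^(2)(t) = 1 / ln(t + 2), so that the entries of f^(2)(t) exp(- t A) are not
   integrable, and L{f^(2)}(H_m^(2)) = L{f^(2)}(0) is infinite. *)
Definition restart_well_defined n m (f : R -> C) (A : 'M[C]_n)
    (H : nat -> 'M[C]_m.+1) (k : nat) : Prop :=
  (forall j, (2 <= j <= k)%N -> laplace_mx_cvg (restart_fun f H j) (H j))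
  /\ (forall j, (2 <= j <= k.+1)%N -> laplace_mx_cvg (restart_fun f H j) A).

End Defs.

(* Main.v *)
(** Write [E_M(t) = exp(-tM)].  By the Arnoldi relation
    [AV = VH + h v e_m^T], the matrix function [D(t) = E_A(t) V E_H(-t)] has
    derivative [-h E_A(t) v e_m^T E_H(-t)].  Writing the next restart function
    [f2] as [f2(t) = e_m^T E_H(-t) K(t)] with [K(t)] the integral of
    [f(s) E_H(s) e_1] over [s >= t], and exchanging two integrals, the integral
    of [-h f2(t) E_A(t) v] over [0, N] is that of
    [f(s) (D(min(s, N)) - D(0)) E_H(s) e_1] over the half line.  As [N] grows this
    tends to [L{f}(A) V e_1 - V L{f}(H) e_1], the error of one cycle in terms of
    the starting vector [V e_1] of that cycle, which is [v] of the previous one;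
    the theorem follows by induction on the cycles.

    Passing to the limit needs an integrable bound of
    [|f(s)| |E_A(u)| |E_H(s - u)|], uniform in [0 <= u <= s].  For a matrix [M]
    with numerical range in [Re >= nu], [exp(nu t) E_M(t)] is a contraction
    semigroup; either its norm stays bounded below, and then convergence of
    [L{f}(M)] makes [f(t) exp(-nu t)] integrable, or [E_M] decays at a rate
    greater than [nu], and it suffices that [f(t) exp(-st)] is integrable for
    every [s > nu]. *)
Require Import Defs.
From HB Require Import structures.
From mathcomp Require Import all_boot all_order all_algebra.
From mathcomp Require Import complex.
From mathcomp Require Import all_classical all_reals all_analysis.
From mathcomp Require Import measurable_realfun.
From mathcomp Require Import ring lra.
Set Implicit Arguments.
Unset Strict Implicit.
Unset Printing Implicit Defensive.
Import Order.TTheory GRing.Theory Num.Theory.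
Import numFieldNormedType.Exports.
Local Open Scope classical_set_scope.
Local Open Scope complex_scope.
Local Open Scope sesquilinear_scope.
Local Open Scope ring_scope.

(** * Lebesgue integrals on the half line *)

Section Translation.
Variable R : realType.
Notation mu := (@lebesgue_measure R).
Implicit Types (t : R) (D : set R) (phi : R -> \bar R).

Lemma measurable_shift t : measurable_fun [set: R] (fun x : R => t + x).
Proof. exact: measurable_funD. Qed.

Lemma measurable_preimage_shift t D : measurable D ->
  measurable [set x | D (t + x)].
Proof. by move=> mD; rewrite -[X in measurable X]setTI; exact: measurable_shift. Qed.

(** Lebesgue measure is determined by its values on intervals, and the pushforward by a translation
    gives every interval its length. *)
Lemma lebesgue_measure_shift t D : measurable D ->
  pushforward mu ((fun x => t + x) : _ -> measurableTypeR R) D = mu D.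
Proof.
move=> mD; have mt := measurable_shift t.
apply/esym/lebesgue_measure_unique => //= _ [[a b]] _ <-.
rewrite /pushforward /=.
have -> : (fun x => t + x) @^-1` `]a, b] = `]a - t, b - t]%classic.
  by apply/seteqP; split => x /=; rewrite !in_itv /=; lra.
rewrite !lebesgue_measure_itv /= !lte_fin ltrD2r -!EFinD.
by congr (if _ then _%:E else _); ring.
Qed.

Lemma ge0_integral_shift t D phi : measurable D -> measurable_fun D phi ->
  {in D, forall y, (0 <= phi y)%E} ->
  (\int[mu]_(y in D) phi y = \int[mu]_(x in [set x | D (t + x)%R]) phi (t + x)%R)%E.
Proof.
move=> mD mphi phi0.
have mt : measurable_fun (T := measurableTypeR R) (U := measurableTypeR R)
    [set: R] (fun x : R => t + x).
  exact: measurable_shift.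
have := ge0_integral_pushforward mt (@lebesgue_measure R) mD mphi phi0.
rewrite /comp => <-.
by apply: eq_measure_integral => //= A mA _; exact/esym/lebesgue_measure_shift.
Qed.

Lemma integral_shift t D phi : measurable D -> measurable_fun D phi ->
  (\int[mu]_(y in D) phi y = \int[mu]_(x in [set x | D (t + x)%R]) phi (t + x)%R)%E.
Proof.
move=> mD mphi; rewrite [LHS]integralE [RHS]integralE; congr (_ - _)%E.
- rewrite (ge0_integral_shift t) //; last exact: measurable_funepos.
  by under eq_integral do rewrite funepos_comp.
- rewrite (ge0_integral_shift t) //; last exact: measurable_funeneg.
  by under eq_integral do rewrite funeneg_comp.
Qed.

Lemma measurable_fun_shift t D phi : measurable D -> measurable_fun D phi ->
  measurable_fun [set x | D (t + x)] (fun x => phi (t + x)).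
Proof.
move=> mD mphi; apply: (@measurable_comp _ _ _ _ _ _ D) => //.
- by move=> _ [x Dx <-].
- exact: measurable_funS (measurable_shift t).
Qed.

Lemma integrable_shift t D phi : measurable D -> mu.-integrable D phi ->
  mu.-integrable [set x | D (t + x)] (fun x => phi (t + x)).
Proof.
move=> mD /integrableP[mphi phioo]; apply/integrableP; split.
  exact: measurable_fun_shift.
rewrite -(@ge0_integral_shift t _ (abse \o phi)) //.
  exact: measurableT_comp.
by move=> y _ /=.
Qed.

End Translation.

(** * Integrability over the plane of products of functions of one variable *)

Section ProductIntegrability.
Variable R : realType.
Notation mu := (@lebesgue_measure R).
Notation RR := (measurableTypeR R * measurableTypeR R)%type.
Implicit Types a k : R -> R.

Lemma measurable_half_line : measurable (@half_line R).
Proof. exact: measurable_itv. Qed.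

Lemma half_lineP (x : R) : half_line x <-> 0 <= x.
Proof. by rewrite /half_line /= in_itv /= andbT. Qed.

Lemma integrable_prod_mul a k :
  mu.-integrable setT (EFin \o a) -> mu.-integrable setT (EFin \o k) ->
  (mu \x mu)%E.-integrable setT (fun z : RR => (a z.1 * k z.2)%:E).
Proof.
move=> /integrableP[/measurable_EFinP ma aoo] /integrableP[/measurable_EFinP mk koo].
apply/integrable12ltyP.
  apply/measurable_EFinP; apply: measurable_funM.
  - exact: (measurableT_comp ma measurable_fst).
  - exact: (measurableT_comp mk measurable_snd).
under eq_integral => x _ /=.
  under eq_integral do rewrite normrM EFinM.
  rewrite ge0_integralZl//; last exact/measurable_EFinP/measurableT_comp.
  over.
rewrite ge0_integralZr ?lte_mul_pinfty ?integral_ge0 //.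
- by rewrite ge0_fin_numE // integral_ge0.
- by apply/measurable_EFinP/measurableT_comp.
Qed.

Lemma measurable_fun_addition : measurable_fun (setT : set RR) (fun z : RR => (z.1 + z.2 : R)).
Proof. by apply: measurable_funD; [exact: measurable_fst|exact: measurable_snd]. Qed.

(** By Tonelli with [z.1] integrated first: translation invariance removes the shift by [z.2], and
    the two L1 norms factor. *)
Lemma integrable_prod_shift_snd a k :
  mu.-integrable setT (EFin \o a) -> mu.-integrable setT (EFin \o k) ->
  (mu \x mu)%E.-integrable setT (fun z : RR => (a (z.1 + z.2) * k z.2)%:E).
Proof.
move=> ia /integrableP[/measurable_EFinP mk koo].
have /integrableP[/measurable_EFinP ma aoo] := ia.
apply/integrable21ltyP.
  apply/measurable_EFinP; apply: measurable_funM.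
  - exact: (measurableT_comp ma measurable_fun_addition).
  - exact: (measurableT_comp mk measurable_snd).
under eq_integral => y _ /=.
  under eq_integral do rewrite normrM EFinM addrC.
  rewrite ge0_integralZr//; last first.
    apply/measurable_EFinP; apply: measurableT_comp => //.
    by apply: measurableT_comp => //; exact: measurable_shift.
  rewrite -[X in (X * _)%E](@ge0_integral_shift _ y setT (fun x => `|a x|%:E)) //; last first.
    by apply/measurable_EFinP; apply: measurableT_comp.
  over.
rewrite ge0_integralZl ?lte_mul_pinfty ?integral_ge0 //.
- by rewrite ge0_fin_numE // integral_ge0.
- by apply/measurable_EFinP/measurableT_comp.
Qed.

(** The mirror case, with [z.2] integrated first. *)
Lemma integrable_prod_shift_fst a k :
  mu.-integrable setT (EFin \o a) -> mu.-integrable setT (EFin \o k) ->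
  (mu \x mu)%E.-integrable setT (fun z : RR => (a (z.1 + z.2) * k z.1)%:E).
Proof.
move=> ia /integrableP[/measurable_EFinP mk koo].
have /integrableP[/measurable_EFinP ma aoo] := ia.
apply/integrable12ltyP.
  apply/measurable_EFinP; apply: measurable_funM.
  - exact: (measurableT_comp ma measurable_fun_addition).
  - exact: (measurableT_comp mk measurable_fst).
under eq_integral => y _ /=.
  under eq_integral do rewrite normrM EFinM.
  rewrite ge0_integralZr//; last first.
    apply/measurable_EFinP; apply: measurableT_comp => //.
    by apply: measurableT_comp => //; exact: measurable_shift.
  rewrite -[X in (X * _)%E](@ge0_integral_shift _ y setT (fun x => `|a x|%:E)) //; last first.
    by apply/measurable_EFinP; apply: measurableT_comp.
  over.
rewrite ge0_integralZl ?lte_mul_pinfty ?integral_ge0 //.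
- by rewrite ge0_fin_numE // integral_ge0.
- by apply/measurable_EFinP/measurableT_comp.
Qed.
End ProductIntegrability.

(** * Exponentially weighted integrability of correlation integrals *)

Section Convolution.
Variable R : realType.
Notation mu := (@lebesgue_measure R).
Notation hl := (@half_line R).
Notation RR := (measurableTypeR R * measurableTypeR R)%type.

Lemma integrable_half_lineE (phi : R -> R) :
  mu.-integrable hl (EFin \o phi) <-> mu.-integrable setT (EFin \o (phi \_ hl)).
Proof.
by rewrite -restrict_EFin; apply: integrable_mkcond; exact: measurable_half_line.
Qed.

Lemma measurable_half_line_patch (f : R -> R) :
  measurable_fun hl f -> measurable_fun setT (f \_ hl).
Proof. by move/(measurable_restrictT _ (@measurable_half_line R)). Qed.

Lemma measurable_expRM (D : set R) (c : R) :
  measurable_fun D (fun t : R => expR (c * t)).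
Proof.
apply: measurable_funTS.
by apply: (measurableT_comp (@measurable_expR R)); exact: measurable_funM.
Qed.

(** Up to the factor [c], the integrand is the density of an exponential law. *)
Lemma integrable_expR (c : R) : 0 < c ->
  mu.-integrable hl (fun t => (expR (- c * t))%:E).
Proof.
move=> c0; have mhl : measurable (hl : set (measurableTypeR R)) := @measurable_half_line R.
have := integrableS measurableT mhl (@subsetT _ _) (integrable_exponential_pdf c0).
move=> /(integrableZl mhl c^-1).
apply: eq_integrable; first exact: measurable_half_line.
move=> t /set_mem /half_lineP t0 /=.
by rewrite -EFinM exponential_pdfE // mulrA mulVf ?mul1r ?gt_eqF // mulNr.
Qed.

Lemma half_line_shift (t x : R) : 0 <= t -> hl x -> hl (t + x).
Proof. by move=> t0 /half_lineP x0; apply/half_lineP; rewrite addr_ge0. Qed.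

Lemma measurable_fun_half_line_shift (p : R -> R) (t : R) : 0 <= t ->
  measurable_fun hl p -> measurable_fun hl (fun x => p (t + x)).
Proof.
move=> t0 mp; apply: (@measurable_comp _ _ _ _ _ _ hl) => //.
- exact: measurable_half_line.
- by move=> _ [x hx <-]; exact: half_line_shift.
- exact: measurable_funS (measurable_shift t).
Qed.

Section conv.
Variables (p q : R -> R) (s c a C : R).
Hypotheses (mp : measurable_fun hl p) (mq : measurable_fun hl q).
Hypothesis ip : mu.-integrable hl (fun t => (p t * expR (- a * t))%:E).
Hypothesis hq : forall t, 0 <= t -> `|q t| <= C * expR (- c * t).
Hypotheses (as_ : a <= s) (ac : a <= c).

(** As [a <= c], [q x] is bounded by [C * expR (- a * x)], so the integrand is dominated by
    [C * expR (a * t)] times the shift by [t] of the integrable function in [ip]. *)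
Lemma conv_integrand_integrable (t : R) : 0 <= t ->
  mu.-integrable hl (fun x => (p (t + x) * q x)%:E).
Proof.
move=> t0; have mhl : measurable (hl : set (measurableTypeR R)) := @measurable_half_line R.
have C0 : 0 <= C.
  have := hq (lexx 0); rewrite mulr0 expR0 mulr1; exact: le_trans.
have := integrable_shift t mhl ip.
have mt : measurable ([set x | hl (t + x)] : set (measurableTypeR R)).
  exact: measurable_preimage_shift.
move=> /(integrableS mt mhl (fun x => half_line_shift t0)).
move=> /(integrableZl mhl (C * expR (a * t))).
apply: le_integrable => //.
  apply/measurable_EFinP/measurable_funM => //.
  exact: measurable_fun_half_line_shift.
move=> x /half_lineP x0 /=.
rewrite lee_fin !normrM mulrC (ger0_norm C0) !(ger0_norm (expR_ge0 _)).
rewrite [leRHS](_ : _ = (C * expR (- a * x)) * `|p (t + x)|); last first.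
  rewrite (_ : - a * (t + x) = - (a * t) + - a * x); last by ring.
  rewrite expRD expRN; have := expR_gt0 (a * t); move: (expR _) => E E0.
  by field; rewrite gt_eqF.
apply: ler_wpM2r => //; apply: (le_trans (hq x0)).
by rewrite ler_wpM2l // ler_expR ler_wpM2r // lerN2.
Qed.

(** On the quarter plane, [p (t + x) * q x * expR (- s * t)] equals [P (t + x) * Q x * W t], because
    the weights cancel. Once this product is integrable on the plane, Fubini gives integrability in
    [t]. *)
Lemma conv_integrable : (a < s) || (a < c) ->
  mu.-integrable hl (fun t => ((\int[mu]_(x in hl) (p (t + x) * q x)) * expR (- s * t))%:E).
Proof.
move=> strict; have mhl : measurable (hl : set (measurableTypeR R)) := @measurable_half_line R.
have C0 : 0 <= C.
  have := hq (lexx 0); rewrite mulr0 expR0 mulr1; exact: le_trans.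
pose P := (fun t => p t * expR (- a * t)) \_ hl.
pose Q := (fun t => q t * expR (a * t)) \_ hl.
pose W := (fun t => expR (- (s - a) * t)) \_ hl.
have iP : mu.-integrable setT (EFin \o P) by exact/integrable_half_lineE.
have mP : measurable_fun setT P by apply/measurable_EFinP; exact: measurable_int iP.
have mQ : measurable_fun setT Q.
  apply: measurable_half_line_patch; apply: measurable_funM => //; exact: measurable_expRM.
have mW : measurable_fun setT W.
  by apply: measurable_half_line_patch; exact: measurable_expRM.
have Qle x : `|Q x| <= C * (((fun t => expR (- (c - a) * t)) \_ hl) x).
  rewrite /Q !patchE; case: ifPn => [/set_mem /half_lineP x0|_]; last by rewrite normr0 mulr0.
  rewrite normrM (ger0_norm (expR_ge0 _)).
  rewrite (_ : - (c - a) * x = - c * x + a * x); last by ring.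
  by rewrite expRD mulrA ler_wpM2r ?expR_ge0 // hq.
have Wle x : `|W x| <= 1.
  rewrite /W patchE; case: ifPn => [/set_mem /half_lineP x0|_]; last by rewrite normr0.
  by rewrite (ger0_norm (expR_ge0 _)) expR_le1 mulNr oppr_le0 mulr_ge0 // subr_ge0.
pose F (z : RR) := P (z.1 + z.2) * Q z.2 * W z.1.
have mF : measurable_fun setT F.
  apply: measurable_funM; [apply: measurable_funM|].
  - exact: (measurableT_comp mP (@measurable_fun_addition R)).
  - exact: (measurableT_comp mQ measurable_snd).
  - exact: (measurableT_comp mW measurable_fst).
have iF : (mu \x mu)%E.-integrable setT (EFin \o F).
  (* [P] is integrable, and one more integrable factor is required: it is [W] if [a < s], with [Q]
     bounded by [C], and [Q] if [a < c], with [W] bounded by 1. *)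
  case/orP: strict => [lt|lt].
    have iW : mu.-integrable setT (EFin \o W).
      by apply/integrable_half_lineE; apply: integrable_expR; rewrite subr_gt0.
    have := integrableZl measurableT C (integrable_prod_shift_fst iP iW).
    apply: le_integrable => //; first exact/measurable_EFinP.
    move=> z _ /=; rewrite lee_fin /F !normrM (ger0_norm C0).
    rewrite [leRHS]mulrCA -mulrA ler_wpM2l // ler_wpM2r //.
    apply: (le_trans (Qle _)); rewrite -[leRHS]mulr1 ler_wpM2l // patchE.
    case: ifPn => [/set_mem /half_lineP x0|_]; last exact: ler01.
    by rewrite expR_le1 mulNr oppr_le0 mulr_ge0 // subr_ge0.
  have iQ : mu.-integrable setT (EFin \o Q).
    have : mu.-integrable setT (EFin \o ((fun t => expR (- (c - a) * t)) \_ hl)).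
      by apply/integrable_half_lineE; apply: integrable_expR; rewrite subr_gt0.
    move=> /(integrableZl measurableT C).
    apply: le_integrable => //; first exact/measurable_EFinP.
    by move=> x _ /=; rewrite lee_fin (le_trans (Qle x)) // ler_norm.
  have := integrable_prod_shift_snd iP iQ.
  apply: le_integrable => //; first exact/measurable_EFinP.
  move=> z _ /=; rewrite lee_fin /F normrM -[leRHS]mulr1 ler_wpM2l //.
have := integrable_fubini_F iF.
move=> /(integrableS measurableT mhl (@subsetT _ _)).
apply: eq_integrable => // t /set_mem ht; have /half_lineP t0 := ht.
rewrite /fubini_F /= /F /=.
have it := conv_integrand_integrable t0.
rewrite /Rintegral EFinM fineK; last exact: integrable_fin_num.
rewrite -integralZr // [RHS]integral_mkcond.
apply: eq_integral => x _; rewrite patchE.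
case: ifPn => [hx|hx]; last by rewrite /Q patchE (negbTE hx) mulr0 mul0r.
rewrite -EFinM /P /Q /W !patchE hx !ifT; last 2 first.
- exact: mem_set.
- by apply/mem_set/half_line_shift => //; exact: set_mem.
congr EFin.
rewrite (_ : - s * t = - a * (t + x) + a * x + - (s - a) * t); last by ring.
by rewrite !expRD; ring.
Qed.

End conv.
End Convolution.

(** * Dominated convergence, the fundamental theorem of calculus and a Fubini exchange *)

Section RealIntegrals.
Variable R : realType.
Notation mu := (@lebesgue_measure R).
Notation hl := (@half_line R).
Notation RR := (measurableTypeR R * measurableTypeR R)%type.

Lemma measurable_leb d (T : measurableType d) (f g : T -> R) :
  measurable_fun setT f -> measurable_fun setT g ->
  measurable_fun setT (fun x => (f x <= g x)%R%:R : R).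
Proof.
move=> mf mg.
rewrite (_ : (fun x => _) = fun x => if f x <= g x then 1 else 0); last first.
  by apply/funext => x; case: (f x <= g x).
by apply: measurable_fun_ifT => //; exact: measurable_fun_ler.
Qed.

Lemma dominated_Rintegral (u_ : nat -> R -> R) (u g : R -> R) :
  (forall n, measurable_fun hl (u_ n)) -> measurable_fun hl u ->
  mu.-integrable hl (EFin \o g) ->
  (forall t, 0 <= t -> u_ ^~ t @ \oo --> u t) ->
  (forall n t, 0 <= t -> `|u_ n t| <= g t) ->
  (fun n => \int[mu]_(t in hl) u_ n t) @ \oo --> \int[mu]_(t in hl) u t.
Proof.
move=> mu_ mu_' ig cvgu leg.
have mhl : measurable (hl : set (measurableTypeR R)) := @measurable_half_line R.
have mEu_ n : measurable_fun hl (EFin \o u_ n) by exact/measurable_EFinP.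
have mEu : measurable_fun hl (EFin \o u) by exact/measurable_EFinP.
have [||iu _ cvgi] := dominated_convergence mhl mEu_ mEu _ ig.
- apply: aeW => t /half_lineP t0.
  by apply: cvg_EFin; [exact: nearW|exact: cvgu].
- by apply: aeW => t n /half_lineP t0 /=; rewrite lee_fin leg.
apply: fine_cvg; rewrite fineK //.
exact: integrable_fin_num.
Qed.

Lemma Rintegral_FTC2 (d d' : R -> R) (x : R) : 0 <= x ->
  (forall t, is_derive t (1 : R) d (d' t)) -> continuous d' ->
  \int[mu]_(t in `[0, x]) d' t = d x - d 0.
Proof.
rewrite le_eqVlt => /predU1P[<- _ _|x0 dd cd'].
  by rewrite set_itv1 Rintegral_set1 subrr.
have cd : continuous d.
  move=> t; apply: differentiable_continuous; apply/derivable1_diffP.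
  by case: (dd t).
rewrite /Rintegral (@continuous_FTC2 _ d' d) //.
- exact: continuous_subspaceT.
- split.
  + by move=> t _; case: (dd t).
  + exact/cvg_at_right_filter/cd.
  + exact/cvg_at_left_filter/cd.
- by move=> t _; rewrite derive1E; case: (dd t).
Qed.

Lemma integrable_prod_mul_le1 (a k : R -> R) (e : RR -> R) :
  mu.-integrable setT (EFin \o a) -> mu.-integrable setT (EFin \o k) ->
  measurable_fun setT e -> (forall z, `|e z| <= 1) ->
  (mu \x mu)%E.-integrable setT (fun z : RR => (a z.1 * k z.2 * e z)%:E).
Proof.
move=> ia ik me e1.
have := integrable_prod_mul ia ik; apply: le_integrable => //.
  apply/measurable_EFinP; apply: measurable_funM => //.
  apply/measurable_EFinP; exact: measurable_int (integrable_prod_mul ia ik).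
by move=> z _ /=; rewrite lee_fin normrM ler_piMr.
Qed.

Section fubini.
Variables (d d' kappa : R -> R) (T : R).
Hypotheses (T0 : 0 <= T) (dd : forall t, is_derive t (1 : R) d (d' t)).
Hypotheses (cd' : continuous d') (ik : mu.-integrable hl (EFin \o kappa)).

(** [F] is supported on [0 <= t <= T], [t <= s]. Integrated in [s] first, it gives [d' t] times the
    tail integral [K t]; integrated in [t] first, it gives [kappa s] times the increment of [d] over
    the interval from 0 to the minimum of [s] and [T]. *)
Let a := (fun t => (t <= T)%R%:R * d' t) \_ hl.
Let k := kappa \_ hl.
Let e (z : RR) : R := (z.1 <= z.2)%R%:R.
Let F (z : RR) := a z.1 * k z.2 * e z.
Let K t := \int[mu]_(s in hl) ((t <= s)%R%:R * kappa s).

Let mhl : measurable (hl : set (measurableTypeR R)) := @measurable_half_line R.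

Let ik' : mu.-integrable setT (EFin \o k).
Proof. exact/integrable_half_lineE. Qed.

(** The cut at [T] leaves a continuous function on a compact interval. *)
Let ia : mu.-integrable setT (EFin \o a).
Proof.
have -> : a = d' \_ `[0, T].
  apply/funext => t; rewrite /a !patchE /half_line.
  case: ifPn => [/set_mem /half_lineP t0|t0].
    case: ifPn => [/set_mem /=|]; rewrite ?notin_setE /= in_itv /= t0 /=.
      by move=> ->; rewrite mul1r.
    by move/negP/negbTE => ->; rewrite mul0r.
  rewrite ifF //; apply/negP => /set_mem /=; rewrite in_itv /= => /andP[t1 _].
  by move: t0; rewrite notin_setE /= in_itv /= t1.
rewrite -restrict_EFin.
have mT : measurable (`[0, T]%classic : set (measurableTypeR R)) := measurable_itv _.
apply: (proj1 (integrable_mkcond _ mT)).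
apply: continuous_compact_integrable; first exact: segment_compact.
exact: continuous_subspaceT.
Qed.

Let measurable_e : measurable_fun setT e.
Proof. by apply: measurable_leb; [exact: measurable_fst|exact: measurable_snd]. Qed.

Let iF : (mu \x mu)%E.-integrable setT (EFin \o F).
Proof.
apply: integrable_prod_mul_le1 => // z.
by rewrite /e normr_nat lern1 leq_b1.
Qed.

(** With the variables exchanged the inner integral is over [t], as [integrable_fubini_head] needs
    it. *)
Let iF' : (mu \x mu)%E.-integrable setT (fun z : RR => (k z.1 * a z.2 * e (z.2, z.1))%:E).
Proof.
apply: (integrable_prod_mul_le1 (e := fun z => e (z.2, z.1))) => //.
  by apply: measurable_leb; [exact: measurable_snd|exact: measurable_fst].
by move=> z; rewrite /e normr_nat lern1 leq_b1.
Qed.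

Lemma integrable_tail t : mu.-integrable hl (fun s => ((t <= s)%R%:R * kappa s)%:E).
Proof.
apply: le_integrable ik => //.
  apply/measurable_EFinP/measurable_funM.
    by apply: measurable_funTS; apply: (measurable_leb (f := fun=> t) (g := fun s => s)).
  by apply/measurable_EFinP; exact: measurable_int ik.
by move=> s _ /=; rewrite lee_fin normrM ler_piMl //= normr_nat lern1 leq_b1.
Qed.

Let F1 t : (\int[mu]_s (F (t, s))%:E = ((a t * K t)%:E))%E.
Proof.
rewrite /K /Rintegral EFinM fineK; last exact/integrable_fin_num/integrable_tail.
rewrite -integralZl //; last exact: integrable_tail.
rewrite [RHS]integral_mkcond; apply: eq_integral => s _; rewrite patchE /F /k patchE.
case: ifPn => _ /=; last by rewrite mulr0 mul0r.
by rewrite -EFinM /e /=; congr EFin; ring.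
Qed.

Let G (s : R) : R := (d (Num.min s T) - d 0) * kappa s.

Let F2 s : (\int[mu]_t (F (t, s))%:E = ((G \_ hl) s)%:E)%E.
Proof.
rewrite patchE; case: ifPn => hs; last first.
  by apply: integral0_eq => t _; rewrite /F /k /= patchE (negbTE hs) mulr0 mul0r.
have s0 : 0 <= s by apply/half_lineP; exact: set_mem.
rewrite /G -(@Rintegral_FTC2 d d') //; last by rewrite le_min s0.
have id' : mu.-integrable `[0, Num.min s T] (EFin \o d').
  apply: continuous_compact_integrable; first exact: segment_compact.
  exact: continuous_subspaceT.
rewrite EFinM fineK; last exact: integrable_fin_num.
rewrite -integralZr // [RHS]integral_mkcond.
apply: eq_integral => t _; rewrite patchE /F /k /= patchE hs /a patchE /e /=.
have -> : (t \in `[0, Num.min s T]%classic) = (t \in hl) && (t <= s) && (t <= T).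
  rewrite !mem_setE !in_itv /= le_min andbT -andbA //.
case: (t \in hl) => /=; last by rewrite !mul0r.
by case: (t <= s); case: (t <= T); rewrite /= ?(mul0r, mulr0, mul1r, mulr1).
Qed.

Lemma integrable_fubini_tail :
  mu.-integrable hl (fun t => ((t <= T)%R%:R * d' t * K t)%:E).
Proof.
have := integrableS measurableT mhl (@subsetT _ _) (integrable_fubini_F iF).
apply: eq_integrable => // t /set_mem ht; rewrite /fubini_F /= F1 /a patchE mem_set //.
Qed.

Lemma integrable_fubini_head :
  mu.-integrable hl (fun s => ((d (Num.min s T) - d 0) * kappa s)%:E).
Proof.
apply/(integrable_mkcond _ mhl).
have := integrable_fubini_F iF'; apply: eq_integrable => // s _.
rewrite /fubini_F /=; transitivity (\int[mu]_t (F (t, s))%:E)%E.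
  by apply: eq_integral => t _; rewrite /F /= (mulrC (a t)).
by rewrite F2 !patchE; case: ifPn.
Qed.

Lemma Rintegral_fubini_tail :
  \int[mu]_(t in hl) ((t <= T)%R%:R * d' t * K t) =
  \int[mu]_(s in hl) ((d (Num.min s T) - d 0) * kappa s).
Proof.
rewrite /Rintegral; congr fine; rewrite integral_mkcond [RHS]integral_mkcond.
have := Fubini iF; rewrite /=.
under eq_integral do rewrite F1.
under [in RHS]eq_integral do rewrite F2.
move=> FF; transitivity (\int[mu]_x (a x * K x)%:E)%E.
  apply: eq_integral => t _; rewrite patchE /a patchE.
  by case: ifPn => _ //; rewrite mul0r.
rewrite FF; apply: eq_integral => s _; rewrite !patchE; by case: ifPn.
Qed.

End fubini.
End RealIntegrals.

(** * Complex-valued functions of a real variable *)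

Notation cRe := (@complex.Re _).
Notation cIm := (@complex.Im _).

Section ComplexFunctions.
Variable R : realType.
Notation mu := (@lebesgue_measure R).
Notation hl := (@half_line R).
Notation C := R[i].
Implicit Types (z w : C) (u v : R -> C).

Lemma cRe0 : cRe (0 : C) = 0. Proof. by []. Qed.
Lemma cReD z w : cRe (z + w) = cRe z + cRe w. Proof. by case: z; case: w. Qed.
Lemma cImD z w : cIm (z + w) = cIm z + cIm w. Proof. by case: z; case: w. Qed.
Lemma cReN z : cRe (- z) = - cRe z. Proof. by case: z. Qed.
Lemma cImN z : cIm (- z) = - cIm z. Proof. by case: z. Qed.
Lemma cReM z w : cRe (z * w) = cRe z * cRe w - cIm z * cIm w.
Proof. by case: z; case: w. Qed.
Lemma cImM z w : cIm (z * w) = cRe z * cIm w + cIm z * cRe w.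
Proof. by case: z; case: w. Qed.
Lemma cRe_sum I (r : seq I) (P : pred I) (F : I -> C) :
  cRe (\sum_(i <- r | P i) F i) = \sum_(i <- r | P i) cRe (F i).
Proof. exact: (big_morph _ cReD cRe0). Qed.
Lemma complex_ext z w : cRe z = cRe w -> cIm z = cIm w -> z = w.
Proof. by case: z; case: w => ? ? ? ? /= -> ->. Qed.
(* Unlike the modulus, this norm is real-valued and it is submultiplicative
   without a detour through square roots. *)
Definition nrm z : R := `|cRe z| + `|cIm z|.

Lemma nrm_ge0 z : 0 <= nrm z. Proof. by rewrite addr_ge0. Qed.
Lemma nrm0 : nrm 0 = 0. Proof. by rewrite /nrm normr0 addr0. Qed.
Lemma nrm1 : nrm 1 = 1. Proof. by rewrite /nrm normr0 addr0 normr1. Qed.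
Lemma nrmN z : nrm (- z) = nrm z. Proof. by rewrite /nrm cReN cImN !normrN. Qed.
Lemma nrmD z w : nrm (z + w) <= nrm z + nrm w.
Proof. by rewrite /nrm cReD cImD addrACA lerD // ler_normD. Qed.
Lemma nrmM z w : nrm (z * w) <= nrm z * nrm w.
Proof.
rewrite /nrm cReM cImM.
apply: (le_trans (lerD (ler_normB _ _) (ler_normD _ _))).
by rewrite !normrM; lra.
Qed.
Lemma nrm_realM (x : R) z : nrm (x%:C * z) = `|x| * nrm z.
Proof. by rewrite /nrm cReM cImM /= !mul0r subr0 addr0 !normrM -mulrDr. Qed.
Lemma nrm_sum I (r : seq I) (P : pred I) (F : I -> C) :
  nrm (\sum_(i <- r | P i) F i) <= \sum_(i <- r | P i) nrm (F i).
Proof.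
elim/big_rec2: _ => [|i y x _ ih]; first by rewrite nrm0.
by apply: (le_trans (nrmD _ _)); rewrite lerD2l.
Qed.
Lemma cRe_le_nrm z : `|cRe z| <= nrm z. Proof. by rewrite lerDl. Qed.
Lemma cIm_le_nrm z : `|cIm z| <= nrm z. Proof. by rewrite lerDr. Qed.

Definition cmeasurable u :=
  measurable_fun hl (cRe \o u) /\ measurable_fun hl (cIm \o u).

Lemma cmeasurable_cst z : cmeasurable (fun=> z).
Proof. by split; exact: measurable_cst. Qed.

Lemma cmeasurableM u v : cmeasurable u -> cmeasurable v ->
  cmeasurable (fun t => u t * v t).
Proof.
move=> [ur ui] [vr vi]; split.
- rewrite (_ : _ \o _ = ((cRe \o u) \* (cRe \o v)) \- ((cIm \o u) \* (cIm \o v))).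
    by apply: measurable_funB; exact: measurable_funM.
  by apply/funext => t /=; rewrite cReM.
- rewrite (_ : _ \o _ = ((cRe \o u) \* (cIm \o v)) \+ ((cIm \o u) \* (cRe \o v))).
    by apply: measurable_funD; exact: measurable_funM.
  by apply/funext => t /=; rewrite cImM.
Qed.

Lemma cmeasurable_real (phi : R -> R) : measurable_fun hl phi ->
  cmeasurable (fun t => (phi t)%:C).
Proof. by move=> mphi; split => //=; exact: measurable_cst. Qed.

Lemma cmeasurable_ext u v : (forall t, 0 <= t -> u t = v t) ->
  cmeasurable u -> cmeasurable v.
Proof.
move=> uv [mr mi]; split.
  by apply: eq_measurable_fun mr => t /set_mem /half_lineP t0 /=; rewrite uv.
by apply: eq_measurable_fun mi => t /set_mem /half_lineP t0 /=; rewrite uv.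
Qed.

Lemma cintegrable_cmeasurable u : cintegrable u -> cmeasurable u.
Proof.
by move=> [/measurable_int /measurable_EFinP mr /measurable_int /measurable_EFinP mi].
Qed.

Let mhl : measurable (hl : set (measurableTypeR R)) := @measurable_half_line R.

Lemma cintegrable_le u (phi : R -> R) : cmeasurable u ->
  mu.-integrable hl (EFin \o phi) -> (forall t, 0 <= t -> nrm (u t) <= phi t) ->
  cintegrable u.
Proof.
move=> [mr mi] iphi le; split; apply: le_integrable iphi => //.
- exact/measurable_EFinP.
- move=> t /half_lineP t0 /=; rewrite lee_fin.
  by apply: le_trans (ler_norm _); apply: le_trans (le _ t0); exact: cRe_le_nrm.
- exact/measurable_EFinP.
- move=> t /half_lineP t0 /=; rewrite lee_fin.
  by apply: le_trans (ler_norm _); apply: le_trans (le _ t0); exact: cIm_le_nrm.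
Qed.

Lemma integrable_nrm u : cintegrable u -> mu.-integrable hl (EFin \o (nrm \o u)).
Proof.
move=> [ir ii].
exact: (integrableD mhl (integrable_norm ir) (integrable_norm ii)).
Qed.

Lemma cintegrable_nrm_le u v : cmeasurable u -> cintegrable v ->
  (forall t, 0 <= t -> nrm (u t) <= nrm (v t)) -> cintegrable u.
Proof. by move=> mu_ iv le; exact: cintegrable_le mu_ (integrable_nrm iv) le. Qed.

Lemma cintegrable_ext u v : (forall t, 0 <= t -> u t = v t) ->
  cintegrable u -> cintegrable v.
Proof.
move=> uv [ir ii]; split.
  by apply: eq_integrable ir => // t /set_mem /half_lineP t0 /=; rewrite uv.
by apply: eq_integrable ii => // t /set_mem /half_lineP t0 /=; rewrite uv.
Qed.

Lemma cintegral_ext u v : (forall t, 0 <= t -> u t = v t) ->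
  cintegral u = cintegral v.
Proof.
move=> uv; congr (_ +i* _).
  by apply: eq_Rintegral => t /set_mem /half_lineP t0; rewrite uv.
by apply: eq_Rintegral => t /set_mem /half_lineP t0; rewrite uv.
Qed.

Lemma cintegrableD u v : cintegrable u -> cintegrable v ->
  cintegrable (fun t => u t + v t).
Proof.
move=> [ur ui] [vr vi]; split.
  by apply: eq_integrable (integrableD mhl ur vr) => // t _ /=; rewrite cReD EFinD.
by apply: eq_integrable (integrableD mhl ui vi) => // t _ /=; rewrite cImD EFinD.
Qed.

Lemma cintegralD u v : cintegrable u -> cintegrable v ->
  cintegral (fun t => u t + v t) = cintegral u + cintegral v.
Proof.
move=> [ur ui] [vr vi]; apply: complex_ext => /=.
  by rewrite -RintegralD //; apply: eq_Rintegral => t _; rewrite cReD.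
by rewrite -RintegralD //; apply: eq_Rintegral => t _; rewrite cImD.
Qed.

Lemma cintegrableZ z u : cintegrable u -> cintegrable (fun t => z * u t).
Proof.
move=> iu; apply: (cintegrable_le (phi := fun t => nrm z * nrm (u t))).
- by apply: cmeasurableM; [exact: cmeasurable_cst|exact: cintegrable_cmeasurable].
- exact: (integrableZl mhl (nrm z) (integrable_nrm iu)).
- by move=> t _; exact: nrmM.
Qed.

Lemma cintegralZ z u : cintegrable u ->
  cintegral (fun t => z * u t) = z * cintegral u.
Proof.
move=> [ur ui].
have iZ (c : R) (phi : R -> R) : mu.-integrable hl (EFin \o phi) ->
    mu.-integrable hl (EFin \o (fun t => c * phi t)).
  by move=> iphi; exact: (integrableZl mhl c iphi).
apply: complex_ext; rewrite ?cReM ?cImM /=.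
  rewrite -!RintegralZl // -RintegralB ?iZ //.
  by apply: eq_Rintegral => t _; rewrite cReM.
rewrite -!RintegralZl // -RintegralD ?iZ //.
by apply: eq_Rintegral => t _; rewrite cImM.
Qed.

Lemma cintegral0 : cintegral (fun=> 0 : C) = 0.
Proof.
by apply: complex_ext => /=; rewrite Rintegral_cst // mul0r.
Qed.

Lemma cintegrable0 : cintegrable (fun=> 0 : C).
Proof. by split; exact: integrable0. Qed.

Lemma cintegrable_sum I (r : seq I) (F : I -> R -> C) :
  (forall i, cintegrable (F i)) -> cintegrable (fun t => \sum_(i <- r) F i t).
Proof.
move=> iF; elim: r => [|i r ih].
  by apply: cintegrable_ext cintegrable0 => t _; rewrite big_nil.
by apply: cintegrable_ext (cintegrableD (iF i) ih) => t _; rewrite big_cons.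
Qed.

Lemma cintegral_sum I (r : seq I) (F : I -> R -> C) :
  (forall i, cintegrable (F i)) ->
  cintegral (fun t => \sum_(i <- r) F i t) = \sum_(i <- r) cintegral (F i).
Proof.
move=> iF; elim: r => [|i r ih].
  rewrite big_nil; transitivity (cintegral (fun=> 0 : C)); last exact: cintegral0.
  by apply: cintegral_ext => t _; rewrite big_nil.
rewrite big_cons -ih -cintegralD //; last exact: cintegrable_sum.
by apply: cintegral_ext => t _; rewrite big_cons.
Qed.

(** Componentwise, to match the limit [climn] in the definition of [expmx]. *)
Definition ccvg (s : nat -> C) (l : C) : Prop :=
  (cRe (s n) @[n --> \oo] --> cRe l) /\ (cIm (s n) @[n --> \oo] --> cIm l).

Lemma ccvg_unique s l l' : ccvg s l -> ccvg s l' -> l = l'.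
Proof.
move=> [lr li] [lr' li']; apply: complex_ext.
  exact: (cvg_unique (@Rhausdorff R) lr lr').
exact: (cvg_unique (@Rhausdorff R) li li').
Qed.

Lemma dominated_cintegral (u_ : nat -> R -> C) u (g : R -> R) :
  (forall n, cmeasurable (u_ n)) -> cmeasurable u ->
  mu.-integrable hl (EFin \o g) ->
  (forall t, 0 <= t -> ccvg (u_ ^~ t) (u t)) ->
  (forall n t, 0 <= t -> nrm (u_ n t) <= g t) ->
  ccvg (fun n => cintegral (u_ n)) (cintegral u).
Proof.
move=> mu_ [mr mi] ig cu le; split => /=.
  apply: (dominated_Rintegral (u_ := fun n t => cRe (u_ n t)) (g := g)) => //.
  - by move=> n; case: (mu_ n).
  - by move=> t t0; case: (cu t t0).
  - by move=> n t t0; apply: le_trans (le n t t0); exact: cRe_le_nrm.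
apply: (dominated_Rintegral (u_ := fun n t => cIm (u_ n t)) (g := g)) => //.
- by move=> n; case: (mu_ n).
- by move=> t t0; case: (cu t t0).
- by move=> n t t0; apply: le_trans (le n t t0); exact: cIm_le_nrm.
Qed.

End ComplexFunctions.

(** * Derivatives, shifts and the Fubini exchange for complex functions *)

Section ComplexCalculus.
Variable R : realType.
Notation mu := (@lebesgue_measure R).
Notation hl := (@half_line R).
Notation C := R[i].
Implicit Types (z w : C) (u v : R -> C).

Lemma cRe_realM (x : R) z : cRe (x%:C * z) = x * cRe z.
Proof. by rewrite cReM /= mul0r subr0. Qed.
Lemma cIm_realM (x : R) z : cIm (x%:C * z) = x * cIm z.
Proof. by rewrite cImM /= mul0r addr0. Qed.

Definition is_cderive u (t : R) (d : C) : Prop :=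
  is_derive t (1 : R) (cRe \o u) (cRe d) /\ is_derive t (1 : R) (cIm \o u) (cIm d).

Lemma is_cderive_cst z t : is_cderive (fun=> z) t 0.
Proof. by split; exact: is_derive_cst. Qed.

Lemma is_cderive_ext u v t d : u =1 v -> is_cderive u t d -> is_cderive v t d.
Proof. by move=> /funext ->. Qed.

Lemma is_cderiveD u v t du dv : is_cderive u t du -> is_cderive v t dv ->
  is_cderive (fun t => u t + v t) t (du + dv).
Proof.
move=> [ur ui] [vr vi]; split.
- rewrite (_ : _ \o _ = (cRe \o u) \+ (cRe \o v)); last first.
    by apply/funext => x /=; rewrite cReD.
  by rewrite cReD; exact: is_deriveD.
- rewrite (_ : _ \o _ = (cIm \o u) \+ (cIm \o v)); last first.
    by apply/funext => x /=; rewrite cImD.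
  by rewrite cImD; exact: is_deriveD.
Qed.

Lemma is_deriveM_fun (f g : R -> R) (t df dg : R) :
  is_derive t (1 : R) f df -> is_derive t (1 : R) g dg ->
  is_derive t (1 : R) (fun x => f x * g x) (df * g t + f t * dg).
Proof.
move=> hf hg; have D := is_deriveM hf hg.
by apply: is_derive_eq; rewrite addrC /GRing.scale /= mulrC.
Qed.

Lemma is_cderiveM u v t du dv : is_cderive u t du -> is_cderive v t dv ->
  is_cderive (fun t => u t * v t) t (du * v t + u t * dv).
Proof.
move=> [ur ui] [vr vi]; split.
- rewrite (_ : _ \o _ = (fun x => cRe (u x) * cRe (v x)) -
                         (fun x => cIm (u x) * cIm (v x))); last first.
    by apply/funext => x /=; rewrite cReM.
  have D := is_deriveB (is_deriveM_fun ur vr) (is_deriveM_fun ui vi).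
  by apply: is_derive_eq; rewrite cReD !cReM /=; ring.
- rewrite (_ : _ \o _ = (fun x => cRe (u x) * cIm (v x)) +
                         (fun x => cIm (u x) * cRe (v x))); last first.
    by apply/funext => x /=; rewrite cImM.
  have D := is_deriveD (is_deriveM_fun ur vi) (is_deriveM_fun ui vr).
  by apply: is_derive_eq; rewrite cImD !cImM /=; ring.
Qed.

Lemma is_cderive_sum I (r : seq I) (F : I -> R -> C) t (dF : I -> C) :
  (forall i, is_cderive (F i) t (dF i)) ->
  is_cderive (fun t => \sum_(i <- r) F i t) t (\sum_(i <- r) dF i).
Proof.
move=> iF; elim: r => [|i r ih].
  rewrite big_nil; apply: is_cderive_ext (is_cderive_cst 0 t).
  by move=> x; rewrite big_nil.
rewrite big_cons; apply: is_cderive_ext (is_cderiveD (iF i) ih).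
by move=> x; rewrite big_cons.
Qed.

Lemma is_cderive0_cst u x y : (forall t, is_cderive u t 0) -> u x = u y.
Proof.
move=> u0; apply: complex_ext.
  by apply: (is_derive_0_is_cst (f := cRe \o u)) => t; case: (u0 t).
by apply: (is_derive_0_is_cst (f := cIm \o u)) => t; case: (u0 t).
Qed.

Lemma is_derive_continuous (f f' : R -> R) :
  (forall t, is_derive t (1 : R) f (f' t)) -> continuous f.
Proof.
move=> df t; apply: differentiable_continuous; apply/derivable1_diffP.
by case: (df t).
Qed.

Definition ccontinuous u := continuous (cRe \o u) /\ continuous (cIm \o u).

Lemma is_cderive_continuous u d : (forall t, is_cderive u t (d t)) -> ccontinuous u.
Proof.
move=> du; split; first by apply: is_derive_continuous => t; case: (du t).
by apply: is_derive_continuous => t; case: (du t).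
Qed.

Lemma ccontinuous_cmeasurable u : ccontinuous u -> cmeasurable u.
Proof.
by move=> [cr ci]; split; apply: measurable_funTS; exact: continuous_measurable_fun.
Qed.

Lemma is_cderive_subl u d (c t : R) : is_cderive u (c - t) d ->
  is_cderive (fun t => u (c - t)) t (- d).
Proof.
have dB : is_derive t (1 : R) (fun t => c - t) (-1).
  have D := is_deriveB (is_derive_cst c t (1 : R)) (is_derive_id t (1 : R)).
  by apply: is_derive_eq; rewrite sub0r.
move=> [ur ui]; split.
- rewrite cReN -mulrN1; apply: (is_derive1_comp (f := cRe \o u)) => //.
- rewrite cImN -mulrN1; apply: (is_derive1_comp (f := cIm \o u)) => //.
Qed.

(** Brings the shifted integrals in the restart functions into the form of the tail integrals [K] of
    the Fubini exchange: the dependence on [t] moves into a cut-off factor. *)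
Lemma Rintegral_half_line_shift (phi : R -> R) (t : R) : 0 <= t ->
  measurable_fun hl phi ->
  \int[mu]_(x in hl) phi (t + x) = \int[mu]_(s in hl) ((t <= s)%R%:R * phi s).
Proof.
move=> t0 mphi.
pose D : set (measurableTypeR R) := `[t, +oo[%classic.
have mD : measurable D by exact: measurable_itv.
have Dhl : D `<=` hl.
  move=> x; rewrite /D /= in_itv /= andbT => tx; apply/half_lineP.
  exact: le_trans tx.
have -> : hl = [set x | D (t + x)].
  by apply/seteqP; split => x /=; rewrite /half_line /D /= !in_itv /= !andbT lerDl.
have mphiD : measurable_fun D (EFin \o phi).
  have mhl : measurable (hl : set (measurableTypeR R)) := @measurable_half_line R.
  apply: (measurable_funS mhl Dhl).
  exact/measurable_EFinP.
rewrite /Rintegral -(integral_shift t mD mphiD); congr fine.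
have -> : [set x | D (t + x)] = hl.
  by apply/seteqP; split => x /=; rewrite /half_line /D /= !in_itv /= !andbT lerDl.
rewrite [LHS]integral_mkcond [RHS]integral_mkcond; apply: eq_integral => x _.
rewrite !patchE mem_setE in_itv /= andbT.
case: ifPn => [tx|tx].
  by rewrite mem_set ?mul1r //; apply/half_lineP; exact: le_trans tx.
by case: ifP => _ //; rewrite mul0r.
Qed.

Lemma cintegral_shift u (t : R) : 0 <= t -> cmeasurable u ->
  cintegral (fun x => u (t + x)) =
  cintegral (fun s => ((t <= s)%R%:R : R)%:C * u s).
Proof.
move=> t0 [mr mi]; congr (_ +i* _).
  rewrite (@Rintegral_half_line_shift (cRe \o u)) //.
  by apply: eq_Rintegral => s _; rewrite cRe_realM.
rewrite (@Rintegral_half_line_shift (cIm \o u)) //.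
by apply: eq_Rintegral => s _; rewrite cIm_realM.
Qed.

Lemma cintegrable_shift u (t : R) : 0 <= t -> cintegrable u ->
  cintegrable (fun x => u (t + x)).
Proof.
have mhl : measurable (hl : set (measurableTypeR R)) := @measurable_half_line R.
have mt : measurable ([set x | hl (t + x)] : set (measurableTypeR R)).
  exact: measurable_preimage_shift.
move=> t0 [ir ii]; have sub := fun x => @half_line_shift R t x t0; split.
  exact: (integrableS mt mhl sub (integrable_shift t mhl ir)).
exact: (integrableS mt mhl sub (integrable_shift t mhl ii)).
Qed.

Section fubini.
Variables (d d' kappa : R -> C) (T : R).
Hypotheses (T0 : 0 <= T) (dd : forall t, is_cderive d t (d' t)).
Hypotheses (cd' : ccontinuous d') (ik : cintegrable kappa).

Let K t := cintegral (fun s => ((t <= s)%R%:R : R)%:C * kappa s).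

Let KRe t : cRe (K t) = \int[mu]_(s in hl) ((t <= s)%R%:R * cRe (kappa s)).
Proof. by apply: eq_Rintegral => s _; rewrite cRe_realM. Qed.

Let KIm t : cIm (K t) = \int[mu]_(s in hl) ((t <= s)%R%:R * cIm (kappa s)).
Proof. by apply: eq_Rintegral => s _; rewrite cIm_realM. Qed.

Let mhl : measurable (hl : set (measurableTypeR R)) := @measurable_half_line R.

Let dr t : is_derive t (1 : R) (cRe \o d) ((cRe \o d') t).
Proof. by case: (dd t). Qed.
Let di t : is_derive t (1 : R) (cIm \o d) ((cIm \o d') t).
Proof. by case: (dd t). Qed.

(** The real and imaginary parts of the product are each a sum or difference of two instances of the
    real case. The two lemmas after this one split in the same way. *)
Lemma cintegrable_fubini_tail :
  cintegrable (fun t => ((t <= T)%R%:R : R)%:C * (d' t * K t)).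
Proof.
have [cr ci] := cd'; have [kr ki] := ik; split.
  apply: eq_integrable (integrableB mhl (integrable_fubini_tail T cr kr)
                                        (integrable_fubini_tail T ci ki)) => // t _ /=.
  by rewrite cRe_realM cReM KRe KIm -EFinB mulrBr !mulrA.
apply: eq_integrable (integrableD mhl (integrable_fubini_tail T cr ki)
                                      (integrable_fubini_tail T ci kr)) => // t _ /=.
by rewrite cIm_realM cImM KRe KIm -EFinD mulrDr !mulrA.
Qed.

Lemma cintegrable_fubini_head :
  cintegrable (fun s => (d (Num.min s T) - d 0) * kappa s).
Proof.
have [cr ci] := cd'; have [kr ki] := ik; split.
  apply: eq_integrable (integrableB mhl (integrable_fubini_head T0 dr cr kr)
                                        (integrable_fubini_head T0 di ci ki)) => // t _ /=.
  by rewrite cReM cReD cImD cReN cImN -EFinB.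
apply: eq_integrable (integrableD mhl (integrable_fubini_head T0 dr cr ki)
                                      (integrable_fubini_head T0 di ci kr)) => // t _ /=.
by rewrite cImM cReD cImD cReN cImN -EFinD.
Qed.

Lemma cintegral_fubini_tail :
  cintegral (fun t => ((t <= T)%R%:R : R)%:C * (d' t * K t)) =
  cintegral (fun s => (d (Num.min s T) - d 0) * kappa s).
Proof.
have [cr ci] := cd'; have [kr ki] := ik; congr (_ +i* _).
  transitivity (\int[mu]_(t in hl) ((t <= T)%R%:R * cRe (d' t) * cRe (K t) -
                                   (t <= T)%R%:R * cIm (d' t) * cIm (K t))).
    by apply: eq_Rintegral => t _; rewrite cRe_realM cReM mulrBr !mulrA.
  under eq_Rintegral do rewrite KRe KIm.
  rewrite RintegralB //; [|exact: integrable_fubini_tail|exact: integrable_fubini_tail].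
  rewrite (Rintegral_fubini_tail T0 dr cr kr) (Rintegral_fubini_tail T0 di ci ki).
  rewrite -RintegralB //;
    [|exact: (integrable_fubini_head T0 dr cr kr)
     |exact: (integrable_fubini_head T0 di ci ki)].
  by apply: eq_Rintegral => s _; rewrite cReM cReD cImD cReN cImN.
transitivity (\int[mu]_(t in hl) ((t <= T)%R%:R * cRe (d' t) * cIm (K t) +
                                 (t <= T)%R%:R * cIm (d' t) * cRe (K t))).
  by apply: eq_Rintegral => t _; rewrite cIm_realM cImM mulrDr !mulrA.
under eq_Rintegral do rewrite KRe KIm.
rewrite RintegralD //; [|exact: integrable_fubini_tail|exact: integrable_fubini_tail].
rewrite (Rintegral_fubini_tail T0 dr cr ki) (Rintegral_fubini_tail T0 di ci kr).
rewrite -RintegralD //;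
  [|exact: (integrable_fubini_head T0 dr cr ki)
   |exact: (integrable_fubini_head T0 di ci kr)].
by apply: eq_Rintegral => s _; rewrite cImM cReD cImD cReN cImN.
Qed.

End fubini.

Section conv.
Variables (p q : R -> C) (s c a B : R).
Hypotheses (mp : cmeasurable p) (mq : cmeasurable q).
Hypothesis ip : cintegrable (fun t => (expR (- a * t))%:C * p t).
Hypothesis hq : forall t, 0 <= t -> nrm (q t) <= B * expR (- c * t).
Hypotheses (as_ : a <= s) (ac : a <= c).

Let mhl : measurable (hl : set (measurableTypeR R)) := @measurable_half_line R.

Let ipr : mu.-integrable hl (fun t => (cRe (p t) * expR (- a * t))%:E).
Proof. by apply: eq_integrable ip.1 => // t _ /=; rewrite cRe_realM mulrC. Qed.
Let ipi : mu.-integrable hl (fun t => (cIm (p t) * expR (- a * t))%:E).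
Proof. by apply: eq_integrable ip.2 => // t _ /=; rewrite cIm_realM mulrC. Qed.
Let hqr t : 0 <= t -> `|cRe (q t)| <= B * expR (- c * t).
Proof. by move=> t0; apply: le_trans (hq t0); exact: cRe_le_nrm. Qed.
Let hqi t : 0 <= t -> `|cIm (q t)| <= B * expR (- c * t).
Proof. by move=> t0; apply: le_trans (hq t0); exact: cIm_le_nrm. Qed.

Lemma conv_cintegrable : (a < s) || (a < c) ->
  cintegrable (fun t => (expR (- s * t))%:C * cintegral (fun x => p (t + x) * q x)).
Proof.
move=> lt; have [pr pi] := mp; have [qr qi] := mq; split.
  apply: eq_integrable (integrableB mhl
    (conv_integrable pr qr ipr hqr as_ ac lt)
    (conv_integrable pi qi ipi hqi as_ ac lt)) => // t /set_mem /half_lineP t0 /=.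
  rewrite mul0r subr0 -EFinB -mulrBl mulrC -RintegralB //.
  - by congr (_ * _)%:E; apply: eq_Rintegral => x _; rewrite cReM.
  - exact: (conv_integrand_integrable pr qr ipr hqr ac t0).
  - exact: (conv_integrand_integrable pi qi ipi hqi ac t0).
apply: eq_integrable (integrableD mhl
  (conv_integrable pr qi ipr hqi as_ ac lt)
  (conv_integrable pi qr ipi hqr as_ ac lt)) => // t /set_mem /half_lineP t0 /=.
rewrite mul0r addr0 -EFinD -mulrDl mulrC -RintegralD //.
- by congr (_ * _)%:E; apply: eq_Rintegral => x _; rewrite cImM.
- exact: (conv_integrand_integrable pr qi ipr hqi ac t0).
- exact: (conv_integrand_integrable pi qr ipi hqr ac t0).
Qed.

End conv.
End ComplexCalculus.

(** * The matrix exponential *)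

Section ComplexLimits.
Variable R : realType.
Notation C := R[i].
Implicit Types (s : nat -> C) (z l : C).

Lemma ccvg_cst z : ccvg (fun=> z) z.
Proof. by split; exact: cvg_cst. Qed.

Lemma ccvg_ext s s' l : s =1 s' -> ccvg s l -> ccvg s' l.
Proof. by move=> /funext ->. Qed.

Lemma ccvgD s s' l l' : ccvg s l -> ccvg s' l' ->
  ccvg (fun n => s n + s' n) (l + l').
Proof.
move=> [sr si] [sr' si']; split.
  rewrite cReD (_ : (fun _ => _) = (fun n => cRe (s n)) \+ (fun n => cRe (s' n))).
    exact: cvgD.
  by apply/funext => n /=; rewrite cReD.
rewrite cImD (_ : (fun _ => _) = (fun n => cIm (s n)) \+ (fun n => cIm (s' n))).
  exact: cvgD.
by apply/funext => n /=; rewrite cImD.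
Qed.

Lemma ccvgM s s' l l' : ccvg s l -> ccvg s' l' ->
  ccvg (fun n => s n * s' n) (l * l').
Proof.
move=> [sr si] [sr' si']; split.
  rewrite cReM; under eq_fun do rewrite cReM.
  by apply: cvgB; apply: cvgM.
rewrite cImM; under eq_fun do rewrite cImM.
by apply: cvgD; apply: cvgM.
Qed.

Lemma ccvg_sum I (r : seq I) (F : I -> nat -> C) (l : I -> C) :
  (forall i, ccvg (F i) (l i)) ->
  ccvg (fun n => \sum_(i <- r) F i n) (\sum_(i <- r) l i).
Proof.
move=> cF; elim: r => [|i r ih].
  rewrite big_nil; apply: ccvg_ext (ccvg_cst 0).
  by move=> n; rewrite big_nil.
rewrite big_cons; apply: ccvg_ext (ccvgD (cF i) ih).
by move=> n; rewrite big_cons.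
Qed.

End ComplexLimits.

(** * A submultiplicative entrywise matrix norm *)

Section MatrixNorm.
Variable R : realType.
Notation C := R[i].

Definition mxnrm m n (M : 'M[C]_(m, n)) : R := \sum_i \sum_j nrm (M i j).

Lemma mxnrm_ge0 m n (M : 'M[C]_(m, n)) : 0 <= mxnrm M.
Proof. by apply: sumr_ge0 => i _; apply: sumr_ge0 => j _; exact: nrm_ge0. Qed.

Lemma nrm_le_mxnrm m n (M : 'M[C]_(m, n)) i j : nrm (M i j) <= mxnrm M.
Proof.
rewrite /mxnrm (bigD1 i) //= (bigD1 j) //= -addrA lerDl addr_ge0 //.
  by apply: sumr_ge0 => k _; exact: nrm_ge0.
by apply: sumr_ge0 => k _; apply: sumr_ge0 => l _; exact: nrm_ge0.
Qed.

Lemma mxnrmM m n p (M : 'M[C]_(m, n)) (N : 'M[C]_(n, p)) :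
  mxnrm (M *m N) <= mxnrm M * mxnrm N.
Proof.
rewrite /mxnrm mulr_suml; apply: ler_sum => i _.
apply: (@le_trans _ _ (\sum_k \sum_j nrm (M i j) * nrm (N j k))).
  apply: ler_sum => k _; rewrite mxE.
  by apply: (le_trans (nrm_sum _ _ _)); apply: ler_sum => j _; exact: nrmM.
rewrite exchange_big mulr_suml; apply: ler_sum => j _.
rewrite -mulr_sumr ler_wpM2l ?nrm_ge0 //.
rewrite [leRHS](bigD1 j) //= lerDl.
by apply: sumr_ge0 => l _; apply: sumr_ge0 => k _; exact: nrm_ge0.
Qed.

Lemma expZmx n (z : C) (M : 'M[C]_n) k : (z *: M) ^+ k = z ^+ k *: M ^+ k.
Proof.
elim: k => [|k ih]; first by rewrite !expr0 scale1r.
by rewrite !exprS ih -!mulmxE -scalemxAl -scalemxAr scalerA.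
Qed.

Lemma nrm_exp_le n (M : 'M[C]_n) k i j : nrm ((M ^+ k) i j) <= mxnrm M ^+ k.
Proof.
elim: k i j => [|k ih] i j.
  by rewrite !expr0 mxE; case: (i == j); rewrite ?nrm1 ?nrm0.
rewrite !exprSr mxE; apply: (le_trans (nrm_sum _ _ _)).
apply: (@le_trans _ _ (\sum_l mxnrm M ^+ k * nrm (M l j))).
  apply: ler_sum => l _; apply: (le_trans (nrmM _ _)).
  by rewrite ler_wpM2r ?nrm_ge0.
rewrite -mulr_sumr ler_wpM2l ?exprn_ge0 ?mxnrm_ge0 // /mxnrm.
apply: ler_sum => l _; rewrite (bigD1 j) //= lerDl.
by apply: sumr_ge0 => p _; exact: nrm_ge0.
Qed.

End MatrixNorm.

(** * Entries of the matrix exponential as real power series *)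

Section ExponentialSeries.
Variables (R : realType) (n : nat) (M : 'M[R[i]]_n) (i j : 'I_n).
Notation C := R[i].
Variable phi : C -> R.
Hypotheses (phiN : forall z, phi (- z) = - phi z)
  (phiD : forall z w, phi (z + w) = phi z + phi w)
  (phiZ : forall (x : R) z, phi (x%:C * z) = x * phi z)
  (phi_le : forall z, `|phi z| <= nrm z).

(** With [phi] the real or the imaginary part, these are the Taylor coefficients in [x] of [phi] of
    the entry [(i, j)] of [P] times the exponential of [- x M]. The factor [P] closes the family
    under differentiation, which turns [P] into [- (P *m M)]. *)
Definition exp_coef (P : 'M[C]_n) (k : nat) : R :=
  (-1) ^+ k * k`!%:R^-1 * phi ((P *m M ^+ k) i j).

Lemma exp_coef_diffs P : pseries_diffs (exp_coef P) = exp_coef (- (P *m M)).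
Proof.
apply/funext => k; rewrite /pseries_diffs /exp_coef.
have -> : (- (P *m M) *m M ^+ k) i j = - ((P *m M ^+ k.+1) i j).
  by rewrite mulNmx exprS -mulmxE mulmxA [LHS]mxE.
rewrite phiN exprS factS natrM invfM mulN1r.
by field; rewrite !pnatr_eq0 -lt0n fact_gt0 /=.
Qed.

(** Comparison with the scalar exponential series, which converges everywhere. *)
Lemma exp_coef_le P x k :
  `|exp_coef P k * x ^+ k| <= mxnrm P * exp_coeff (mxnrm M * `|x|) k.
Proof.
have phi_bound : `|phi ((P *m M ^+ k) i j)| <= mxnrm P * mxnrm M ^+ k.
  apply: (le_trans (phi_le _)); rewrite mxE.
  apply: (le_trans (nrm_sum _ _ _)).
  apply: (@le_trans _ _ (\sum_l nrm (P i l) * mxnrm M ^+ k)).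
    apply: ler_sum => l _; apply: (le_trans (nrmM _ _)).
    by rewrite ler_wpM2l ?nrm_ge0 // nrm_exp_le.
  rewrite -mulr_suml ler_wpM2r ?exprn_ge0 ?mxnrm_ge0 // /mxnrm.
  rewrite [leRHS](bigD1 i) //= lerDl.
  by apply: sumr_ge0 => p _; apply: sumr_ge0 => q _; exact: nrm_ge0.
rewrite /exp_coef /exp_coeff /= !normrM normrX normrN1 expr1n mul1r.
have E0 : 0 <= k`!%:R^-1 * `|x| ^+ k by rewrite mulr_ge0 ?invr_ge0 ?exprn_ge0.
rewrite normrX (ger0_norm (_ : 0 <= k`!%:R^-1)) ?invr_ge0 // exprMn.
have := ler_wpM2r E0 phi_bound; congr (_ <= _); ring.
Qed.

Lemma is_cvg_exp_coef P x : cvgn (pseries (exp_coef P) x).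
Proof.
apply: normed_cvg; rewrite /normed_series_of /=.
apply: (@series_le_cvg _ _ (fun k => mxnrm P * exp_coeff (mxnrm M * `|x|) k)).
- by move=> k.
- by move=> k; apply: le_trans (exp_coef_le P x k).
- by move=> k; exact: exp_coef_le.
- exact/is_cvg_seriesZ/is_cvg_series_exp_coeff.
Qed.

Lemma is_derive_exp_coef P (t : R) :
  is_derive t (1 : R) (fun x => limn (pseries (exp_coef P) x))
    (limn (pseries (exp_coef (- (P *m M))) t)).
Proof.
(* Any radius greater than the modulus of [t] serves, since all these series converge everywhere. *)
rewrite -exp_coef_diffs; apply: (@pseries_snd_diffs _ _ (`|t| + 1)).
- exact: is_cvg_exp_coef.
- by rewrite exp_coef_diffs; exact: is_cvg_exp_coef.
- by rewrite !exp_coef_diffs; exact: is_cvg_exp_coef.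
- by rewrite [ltRHS]ger0_norm ?ltrDl ?addr_ge0.
Qed.

Lemma exp_coef_series P (t : R) N :
  phi ((P *m (\sum_(k < N) (k`!%:R)^-1 *: (- t%:C *: M) ^+ k)) i j) =
  pseries (exp_coef P) t N.
Proof.
have phi0 : phi 0 = 0 by rewrite -(mul0r 0) (phiZ 0 0) mul0r.
rewrite mulmx_sumr summxE (big_morph _ phiD phi0).
rewrite /pseries /series /= big_mkord; apply: eq_bigr => k _.
rewrite expZmx -!scalemxAr 2!mxE mulrA.
rewrite (_ : _ * (- t%:C) ^+ k = (k`!%:R^-1 * (- t) ^+ k)%:C); last first.
  rewrite rmorphM rmorphXn rmorphV ?unitfE ?pnatr_eq0 -?lt0n ?fact_gt0 //=.
  by rewrite rmorph_nat rmorphN.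
by rewrite phiZ /exp_coef (exprNn t); ring.
Qed.

End ExponentialSeries.

Section MatrixExponential.
Variables (R : realType) (n : nat) (M : 'M[R[i]]_n).
Notation C := R[i].

(** This is [E_M]; with the sign of the Laplace kernel it solves [X' = - M X]. *)
Definition mxflow (t : R) : 'M[C]_n := expmx (- t%:C *: M).

Let partial (t : R) (N : nat) := \sum_(k < N) (k`!%:R)^-1 *: (- t%:C *: M) ^+ k.

Let Re_partial i j P t N :
  cRe ((P *m partial t N) i j) = pseries (exp_coef M i j cRe P) t N.
Proof. by apply: exp_coef_series; [exact: cReD|exact: cRe_realM]. Qed.

Let Im_partial i j P t N :
  cIm ((P *m partial t N) i j) = pseries (exp_coef M i j cIm P) t N.
Proof. by apply: exp_coef_series; [exact: cImD|exact: cIm_realM]. Qed.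

Let Re_cvg i j P t : cvgn (pseries (exp_coef M i j cRe P) t).
Proof. by apply: is_cvg_exp_coef; exact: cRe_le_nrm. Qed.

Let Im_cvg i j P t : cvgn (pseries (exp_coef M i j cIm P) t).
Proof. by apply: is_cvg_exp_coef; exact: cIm_le_nrm. Qed.

Lemma mxflow_cvg t i j : ccvg (fun N => partial t N i j) (mxflow t i j).
Proof.
have eR : (fun N => cRe (partial t N i j)) = pseries (exp_coef M i j cRe 1%:M) t.
  by apply/funext => N; rewrite -Re_partial mul1mx.
have eI : (fun N => cIm (partial t N i j)) = pseries (exp_coef M i j cIm 1%:M) t.
  by apply/funext => N; rewrite -Im_partial mul1mx.
rewrite /mxflow /expmx mxE; split; rewrite /climn /=; move: eR eI.
  by rewrite /partial => -> _; exact: Re_cvg.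
by rewrite /partial => _ ->; exact: Im_cvg.
Qed.

Lemma mulmx_flow_cvg (P : 'M[C]_n) (t : R) i j :
  ccvg (fun N => (P *m partial t N) i j) ((P *m mxflow t) i j).
Proof.
rewrite mxE; under [X in ccvg X]eq_fun do rewrite mxE.
by apply: ccvg_sum => k; apply: ccvgM (mxflow_cvg _ _ _); exact: ccvg_cst.
Qed.

Lemma flow_mulmx_cvg (P : 'M[C]_n) (t : R) i j :
  ccvg (fun N => (partial t N *m P) i j) ((mxflow t *m P) i j).
Proof.
rewrite mxE; under [X in ccvg X]eq_fun do rewrite mxE.
by apply: ccvg_sum => k; apply: ccvgM (mxflow_cvg _ _ _) _; exact: ccvg_cst.
Qed.

Lemma mxflow_comm t : M *m mxflow t = mxflow t *m M.
Proof.
apply/matrixP => i j; apply: ccvg_unique (mulmx_flow_cvg M t i j) _.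
apply: ccvg_ext (flow_mulmx_cvg M t i j) => N.
congr (fun_of_matrix _ i j); rewrite /partial mulmx_suml mulmx_sumr.
apply: eq_bigr => k _; rewrite -scalemxAl -scalemxAr expZmx -scalemxAl -scalemxAr.
by rewrite !mulmxE -exprS -exprSr.
Qed.

Lemma mxflow0 : mxflow 0 = 1%:M.
Proof.
apply/matrixP => i j; apply: ccvg_unique (mxflow_cvg 0 i j) _.
(* The empty partial sum is 0, not the identity, so the limit is taken along [N.+1]. *)
have E N : partial 0 N.+1 = 1%:M.
  rewrite /partial big_ord_recl /= fact0 invr1 scale1r expr0 big1 ?addr0 //.
  by move=> k _; rewrite oppr0 scale0r expr0n /= scaler0.
split; rewrite -cvg_shiftS /=.
  by under eq_fun do rewrite E; exact: cvg_cst.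
by under eq_fun do rewrite E; exact: cvg_cst.
Qed.

(** The flow and its derivative are limits of power series of the same family, for [P] equal to the
    identity and to [- M]. *)
Lemma mxflow_derive t i j :
  is_cderive (fun t => mxflow t i j) t (- (M *m mxflow t) i j).
Proof.
have lim1 (x : R) : mxflow x i j = limn (pseries (exp_coef M i j cRe 1%:M) x) +i*
                                   limn (pseries (exp_coef M i j cIm 1%:M) x).
  have [lr li] := mxflow_cvg x i j; apply: complex_ext => /=; apply/esym/cvg_lim => //.
    rewrite (_ : pseries _ _ = fun N => cRe (partial x N i j)) //.
    by apply/funext => N; rewrite -Re_partial mul1mx.
  rewrite (_ : pseries _ _ = fun N => cIm (partial x N i j)) //.
  by apply/funext => N; rewrite -Im_partial mul1mx.
have limM : - (M *m mxflow t) i j =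
    limn (pseries (exp_coef M i j cRe (- (1%:M *m M))) t) +i*
    limn (pseries (exp_coef M i j cIm (- (1%:M *m M))) t).
  rewrite mul1mx; have [lr li] := mulmx_flow_cvg (- M) t i j.
  have <- : (- M *m mxflow t) i j = - (M *m mxflow t) i j by rewrite mulNmx [LHS]mxE.
  apply: complex_ext => /=; apply/esym/cvg_lim => //.
    rewrite (_ : pseries _ _ = fun N => cRe ((- M *m partial t N) i j)) //.
    by apply/funext => N; rewrite -Re_partial.
  rewrite (_ : pseries _ _ = fun N => cIm ((- M *m partial t N) i j)) //.
  by apply/funext => N; rewrite -Im_partial.
rewrite limM; split.
  rewrite (_ : _ \o _ = fun x => limn (pseries (exp_coef M i j cRe 1%:M) x)).
    by apply: is_derive_exp_coef; [exact: cReN|exact: cRe_le_nrm].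
  by apply/funext => x /=; rewrite lim1.
rewrite (_ : _ \o _ = fun x => limn (pseries (exp_coef M i j cIm 1%:M) x)).
  by apply: is_derive_exp_coef; [exact: cImN|exact: cIm_le_nrm].
by apply/funext => x /=; rewrite lim1.
Qed.

End MatrixExponential.

(** * Derivatives of matrix functions and the semigroup law *)

Section MatrixDerivative.
Variable R : realType.
Notation C := R[i].

Definition is_mxderive m n (X : R -> 'M[C]_(m, n)) (t : R) (D : 'M[C]_(m, n)) :=
  forall i j, is_cderive (fun x => X x i j) t (D i j).

Lemma is_mxderive_cst m n (P : 'M[C]_(m, n)) t : is_mxderive (fun=> P) t 0.
Proof. by move=> i j; rewrite mxE; exact: is_cderive_cst. Qed.

Lemma is_mxderiveM m n p (X : R -> 'M[C]_(m, n)) (Y : R -> 'M[C]_(n, p)) t dX dY :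
  is_mxderive X t dX -> is_mxderive Y t dY ->
  is_mxderive (fun x => X x *m Y x) t (dX *m Y t + X t *m dY).
Proof.
move=> hX hY i j; rewrite !mxE -big_split /=.
apply: is_cderive_ext (is_cderive_sum _ (fun k => is_cderiveM (hX i k) (hY k j))).
by move=> x; rewrite mxE.
Qed.

Lemma is_mxderive_mulmxl m n p (P : 'M[C]_(m, n)) (Y : R -> 'M[C]_(n, p)) t dY :
  is_mxderive Y t dY -> is_mxderive (fun x => P *m Y x) t (P *m dY).
Proof.
by move=> /(is_mxderiveM (is_mxderive_cst P t)); rewrite mul0mx add0r.
Qed.

Lemma is_mxderive_mulmxr m n p (X : R -> 'M[C]_(m, n)) (P : 'M[C]_(n, p)) t dX :
  is_mxderive X t dX -> is_mxderive (fun x => X x *m P) t (dX *m P).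
Proof.
by move=> hX; have := is_mxderiveM hX (is_mxderive_cst P t); rewrite mulmx0 addr0.
Qed.

Lemma is_mxderive0_cst m n (X : R -> 'M[C]_(m, n)) x y :
  (forall t, is_mxderive X t 0) -> X x = X y.
Proof.
move=> X0; apply/matrixP => i j.
apply: (is_cderive0_cst (u := fun t => X t i j)) => t.
by have := X0 t i j; rewrite mxE.
Qed.

Lemma mxflow_mxderive n (M : 'M[C]_n) t :
  is_mxderive (mxflow M) t (- (M *m mxflow M t)).
Proof. by move=> i j; rewrite mxE; exact: mxflow_derive. Qed.

Lemma mxflow_mxderive_subl n (M : 'M[C]_n) (c t : R) :
  is_mxderive (fun x => mxflow M (c - x)) t (M *m mxflow M (c - t)).
Proof.
move=> i j; rewrite -[X in is_cderive _ _ X]opprK.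
apply: (is_cderive_subl (u := fun x => mxflow M x i j)).
exact: mxflow_derive.
Qed.

(** The product [U x] of the flows at [x] and [s + t - x] has derivative zero; compare its values at
    0 and at [s]. *)
Lemma mxflowD n (M : 'M[C]_n) (s t : R) :
  mxflow M (s + t) = mxflow M s *m mxflow M t.
Proof.
pose U x := mxflow M x *m mxflow M (s + t - x).
transitivity (U 0); first by rewrite /U mxflow0 mul1mx subr0.
transitivity (U s); last by rewrite /U (addrC s) addrK.
apply: is_mxderive0_cst => x.
have -> : (0 : 'M[C]_n) = - (M *m mxflow M x) *m mxflow M (s + t - x) +
              mxflow M x *m (M *m mxflow M (s + t - x)).
  by rewrite [X in _ + X]mulmxA -mxflow_comm mulNmx addNr.
exact: is_mxderiveM (mxflow_mxderive M x) (mxflow_mxderive_subl M (s + t) x).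
Qed.

End MatrixDerivative.

(** * Decay of the exponential and the numerical range *)

Section Contraction.
Variable R : realType.
Notation C := R[i].

Lemma cRe_conj (z : C) : cRe (Num.conj z) = cRe z. Proof. by case: z. Qed.
Lemma cIm_conj (z : C) : cIm (Num.conj z) = - cIm z. Proof. by case: z. Qed.

Lemma is_mxderive_adjoint m n (X : R -> 'M[C]_(m, n)) t D :
  is_mxderive X t D -> is_mxderive (fun x => (X x) ^t*) t (D ^t*).
Proof.
move=> hX i j; have [hr hi] := hX j i; split.
  rewrite !mxE cRe_conj (_ : _ \o _ = cRe \o (fun x => X x j i)) //.
  by apply/funext => x /=; rewrite !mxE cRe_conj.
rewrite !mxE cIm_conj (_ : _ \o _ = - (cIm \o (fun x => X x j i))).
  exact: is_deriveN.
by apply/funext => x /=; rewrite !mxE cIm_conj.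
Qed.

Lemma adjointM m n p (X : 'M[C]_(m, n)) (Y : 'M[C]_(n, p)) :
  (X *m Y) ^t* = Y ^t* *m X ^t*.
Proof. by rewrite trmx_mul map_mxM. Qed.

Lemma adjointK m n (X : 'M[C]_(m, n)) : (X ^t*) ^t* = X.
Proof. by apply/matrixP => i j; rewrite !mxE conjCK. Qed.

Lemma adjointN m n (X : 'M[C]_(m, n)) : (- X) ^t* = - (X ^t*).
Proof. by apply/matrixP => i j; rewrite !mxE rmorphN. Qed.

(** The square of [norm2] as a real number, which keeps the energy estimate free of roots. *)
Definition sqnorm n (y : 'cV[C]_n) : R := cRe ((y ^t* *m y) 0 0).

Lemma sqnormE n (y : 'cV[C]_n) :
  sqnorm y = \sum_i (cRe (y i 0) ^+ 2 + cIm (y i 0) ^+ 2).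
Proof.
rewrite /sqnorm mxE cRe_sum; apply: eq_bigr => i _.
by rewrite !mxE cReM cRe_conj cIm_conj; ring.
Qed.

Lemma sqnorm_ge0 n (y : 'cV[C]_n) : 0 <= sqnorm y.
Proof. by rewrite sqnormE; apply: sumr_ge0 => i _; rewrite addr_ge0 ?sqr_ge0. Qed.

Lemma nrm_sqr_le_sqnorm n (y : 'cV[C]_n) i : nrm (y i 0) ^+ 2 <= 2 * sqnorm y.
Proof.
have : cRe (y i 0) ^+ 2 + cIm (y i 0) ^+ 2 <= sqnorm y.
  rewrite sqnormE (bigD1 i) //= lerDl.
  by apply: sumr_ge0 => k _; rewrite addr_ge0 ?sqr_ge0.
rewrite /nrm -(real_normK (num_real (cRe _))) -(real_normK (num_real (cIm _))).
move: (`|_|) (`|_|) (sqnorm y) => a b c; have := sqr_ge0 (a - b); nra.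
Qed.

(** The homogeneous form of the condition that the numerical range lies in [Re >= nu]; it passes
    easily to compressions of [M]. *)
Definition accretive n (M : 'M[C]_n) (nu : R) : Prop :=
  forall y : 'cV[C]_n, nu * sqnorm y <= cRe ((y ^t* *m M *m y) 0 0).

Section flow.
Variables (n : nat) (M : 'M[C]_n) (nu : R).
Hypothesis acc : accretive M nu.

Lemma sqnorm_flow_derive (x : 'cV[C]_n) (t : R) :
  is_derive t (1 : R) (fun t => sqnorm (mxflow M t *m x))
    (- 2 * cRe (((mxflow M t *m x) ^t* *m M *m (mxflow M t *m x)) 0 0)).
Proof.
set y := fun t => mxflow M t *m x.
have dy : is_mxderive y t (- (M *m y t)).
  by rewrite /y mulmxA -mulNmx; apply: is_mxderive_mulmxr; exact: mxflow_mxderive.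
have [D _] := is_mxderiveM (is_mxderive_adjoint dy) dy 0 0.
apply: is_derive_eq D _.
set P := (y t) ^t* *m M *m y t.
have PE (z : 'cV[C]_n) : (- (M *m z)) ^t* *m z = - ((z ^t* *m M *m z) ^t*).
  by rewrite adjointN !adjointM adjointK mulNmx mulmxA.
rewrite (PE (y t)) -/P.
rewrite mulmxN mulmxA -/P !mxE cReD !cReN cRe_conj; ring.
Qed.

(** Energy estimate: by accretivity, the derivative of [expR (2 * nu * s)] times the squared norm of
    the trajectory is nonpositive. *)
Lemma sqnorm_flow_le (x : 'cV[C]_n) (t : R) : 0 <= t ->
  sqnorm (mxflow M t *m x) <= expR (- (2 * nu) * t) * sqnorm x.
Proof.
move=> t0; pose q s := sqnorm (mxflow M s *m x).
pose G s := expR (2 * nu * s) * q s.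
pose dG s : R := expR (2 * nu * s) * (2 * nu * q s -
   2 * cRe (((mxflow M s *m x) ^t* *m M *m (mxflow M s *m x)) 0 0)).
have dGE s : is_derive s (1 : R) G (dG s).
  have de : is_derive s (1 : R) (fun s => expR (2 * nu * s)) (2 * nu * expR (2 * nu * s)).
    have dl : is_derive s (1 : R) (fun s => 2 * nu * s) (2 * nu).
      have D := is_deriveZ (2 * nu) (is_derive_id s (1 : R)).
      by apply: is_derive_eq; rewrite /GRing.scale /= mulr1.
    have D := is_derive1_comp (is_derive_expR (2 * nu * s)) dl.
    by apply: is_derive_eq D _; exact: mulrC.
  have D := is_deriveM_fun de (sqnorm_flow_derive x s).
  by apply: is_derive_eq D _; rewrite /dG /q; ring.
have G0 : G t <= G 0.
  apply: (ler0_derive1_le_cc (a := 0) (b := t)) => //.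
  - move=> s _; rewrite derive1E; case: (dGE s) => _ ->.
    rewrite /dG pmulr_rle0 ?expR_gt0 // subr_le0 -mulrA ler_pM2l //.
    exact: acc.
  - by apply: continuous_subspaceT; exact: is_derive_continuous dGE.
  - by rewrite in_itv /= lexx t0.
  - by rewrite in_itv /= lexx t0.
move: G0; rewrite /G /q mulr0 expR0 mul1r mxflow0 mul1mx => G0.
by rewrite mulNr expRN ler_pdivlMl ?expR_gt0.
Qed.

(** The energy estimate for the canonical vector of index [j]. Passing from [sqnorm] to [nrm] costs
    the square root of 2, rounded up to 2. *)
Lemma nrm_flow_le (t : R) i j : 0 <= t ->
  nrm (mxflow M t i j) <= 2 * expR (- nu * t).
Proof.
move=> t0; pose x : 'cV[C]_n := delta_mx j 0.
have x1 : sqnorm x = 1.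
  rewrite sqnormE (bigD1 j) //= big1 => [|k kj]; rewrite !mxE /= ?eqxx /=.
    by rewrite expr1n expr0n /= !addr0.
  by rewrite (negbTE kj) /= expr0n /= addr0.
have := nrm_sqr_le_sqnorm (mxflow M t *m x) i.
have -> : (mxflow M t *m x) i 0 = mxflow M t i j.
  by rewrite /x -colE mxE.
have := sqnorm_flow_le x t0; rewrite x1 mulr1.
have -> : expR (- (2 * nu) * t) = expR (- nu * t) ^+ 2.
  by rewrite -expRM_natl; congr expR; ring.
have := expR_gt0 (- nu * t); have := nrm_ge0 (mxflow M t i j).
move: (nrm _) (expR _) (sqnorm _) => a b c; nra.
Qed.

Lemma mxnrm_flow_le : exists2 B, 0 <= B &
  forall t, 0 <= t -> mxnrm (mxflow M t) <= B * expR (- nu * t).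
Proof.
exists (\sum_(i < n) \sum_(j < n) 2).
  by apply: sumr_ge0 => i _; apply: sumr_ge0.
move=> t t0; rewrite mulr_suml; apply: ler_sum => i _.
by rewrite mulr_suml; apply: ler_sum => j _; exact: nrm_flow_le.
Qed.

(* [expR (nu * t) *: mxflow M t] is a bounded semigroup and [mxnrm] is
   submultiplicative, so dropping below 1 once forces exponential decay; this
   replaces a spectral analysis of [M]. *)
Lemma mxnrm_flow_dichotomy :
  (forall t, 0 <= t -> expR (- nu * t) <= mxnrm (mxflow M t)) \/
  exists2 gamma, nu < gamma & exists2 B, 0 <= B &
    forall t, 0 <= t -> mxnrm (mxflow M t) <= B * expR (- gamma * t).
Proof.
pose w t := mxnrm (mxflow M t) * expR (nu * t).
have wE t : mxnrm (mxflow M t) = w t * expR (- nu * t).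
  by rewrite /w -mulrA -expRD mulNr subrr expR0 mulr1.
have w0 t : 0 <= w t by rewrite mulr_ge0 ?mxnrm_ge0 ?expR_ge0.
have wD s t : w (s + t) <= w s * w t.
  rewrite /w mulrDr expRD mulrACA ler_wpM2r ?mulr_ge0 ?expR_ge0 //.
  by rewrite mxflowD mxnrmM.
have [B B0 wB] : exists2 B, 0 <= B & forall t, 0 <= t -> w t <= B.
  have [B B0 hB] := mxnrm_flow_le; exists B => // t t0.
  have := hB _ t0; rewrite wE ler_pM2r ?expR_gt0 //.
have [ge1|/existsNP[t0 /not_implyP[t00 /negP]]] :=
    pselect (forall t, 0 <= t -> expR (- nu * t) <= mxnrm (mxflow M t)).
  by left.
rewrite -ltNge => lt0; right.
have wt0 : w t0 < 1.
  have <- : expR (- nu * t0) * expR (nu * t0) = 1.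
    by rewrite -expRD mulNr addNr expR0.
  by rewrite /w ltr_pM2r ?expR_gt0.
have t01 : 0 <= t0 by [].
(* If [w 0 < 1], then [w t <= w t * w 0] forces [w] to vanish, which happens in dimension 0 only;
   any rate above [nu] then serves. *)
have [t0E|t0N0] := eqVneq t0 0.
  exists (nu + 1); first by rewrite ltrDl.
  exists 0 => // t tge0; rewrite mul0r wE pmulr_lle0 ?expR_gt0 //.
  have := wD t 0; rewrite addr0; move: wt0 (w0 t); rewrite t0E.
  move: (w t) (w 0) => a b; nra.
have t0gt0 : 0 < t0 by rewrite lt_neqAle eq_sym t0N0.
(* The maximum with one half keeps [rho] positive, so that its logarithm defines the extra decay
   rate [delta]. *)
pose rho := Num.max (w t0) 2^-1.
have rho0 : 0 < rho by rewrite lt_max invr_gt0 ltr0n orbT.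
have rho1 : rho < 1 by rewrite gt_max wt0 invf_lt1 // ltr1n.
pose delta := - ln rho / t0.
have delta0 : 0 < delta by rewrite divr_gt0 // oppr_gt0 ln_lt0 // rho0.
have rhoE : rho = expR (- delta * t0).
  by rewrite /delta mulNr mulrVK ?unitfE // opprK lnK // posrE.
clearbody delta.
exists (nu + delta); first by rewrite ltrDl.
exists (B * expR (delta * t0)); first by rewrite mulr_ge0 ?expR_ge0.
move=> t tge0; rewrite wE.
have -> : B * expR (delta * t0) * expR (- (nu + delta) * t) =
          (B * expR (delta * t0 - delta * t)) * expR (- nu * t).
  rewrite -mulrA -[RHS]mulrA -!expRD; congr (_ * expR _); ring.
rewrite ler_pM2r ?expR_gt0 //.
have tt0 : 0 <= t / t0 by rewrite divr_ge0.
pose N := Num.truncn (t / t0).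
have /andP[Nle Ngt] : N%:R <= t / t0 < N.+1%:R by exact: truncn_itv.
(* Each full period [t0] contributes a factor [rho], and the remainder costs [B]. Since [N] exceeds
   [t / t0 - 1], rounding down loses at most the factor [expR (delta * t0)]. *)
have wN k r : 0 <= r -> w (k%:R * t0 + r) <= B * rho ^+ k.
  move=> r0; elim: k => [|k ih]; first by rewrite mul0r add0r expr0 mulr1 wB.
  have -> : k.+1%:R * t0 + r = t0 + (k%:R * t0 + r) by rewrite -natr1; ring.
  rewrite exprS mulrCA.
  apply: (le_trans (wD _ _)); apply: ler_pM => //.
  by rewrite le_max lexx.
have -> : t = N%:R * t0 + (t - N%:R * t0) by ring.
apply: (le_trans (wN _ _ _)); first by rewrite subr_ge0 -ler_pdivlMr.
rewrite ler_wpM2l // rhoE -expRM_natl ler_expR.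
move: Ngt; rewrite ltr_pdivrMr // -natr1; nra.
Qed.

End flow.
End Contraction.

(** * Accretivity from the field of values *)

Section NumericalRange.
Variable R : realType.
Notation C := R[i].

Lemma sqnormZ n (r : R) (y : 'cV[C]_n) : sqnorm (r%:C *: y) = r ^+ 2 * sqnorm y.
Proof.
rewrite !sqnormE mulr_sumr; apply: eq_bigr => i _.
by rewrite mxE cRe_realM cIm_realM; ring.
Qed.

Lemma norm2_sqnorm1 n (y : 'cV[C]_n) : sqnorm y = 1 -> norm2 y = 1.
Proof.
move=> y1; rewrite /norm2 (_ : \sum_i _ = (sqnorm y)%:C); last first.
  by rewrite sqnormE rmorph_sum; apply: eq_bigr => i _; exact/esym/add_Re2_Im2.
by rewrite y1 sqrtC1.
Qed.

(** A nonzero vector is scaled to norm 1, where its quadratic form lies in the field of values; for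
    the zero vector both sides vanish. *)
Lemma accretive_field_of_values n (A : 'M[C]_n) (nu : R) :
  is_min [set cRe z | z in field_of_values A] nu -> accretive A nu.
Proof.
move=> [_ lb] y; have [y0|y0] := eqVneq (sqnorm y) 0.
  have -> : y = 0.
    apply/matrixP => i j; rewrite (ord1 j) mxE.
    have := nrm_sqr_le_sqnorm y i; rewrite y0 mulr0.
    have := sqr_ge0 (nrm (y i 0)) => h1 h2.
    have /eqP : nrm (y i 0) ^+ 2 = 0 by apply/le_anti; rewrite h1 h2.
    rewrite sqrf_eq0 paddr_eq0 // !normr_eq0 => /andP[/eqP r0 /eqP i0].
    exact: complex_ext.
  by rewrite /sqnorm mulmx0 mxE mulr0 mulmx0 mxE.
have q0 : 0 < sqnorm y by rewrite lt_neqAle eq_sym y0 sqnorm_ge0.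
pose r := (Num.sqrt (sqnorm y))^-1.
have r2 : r ^+ 2 = (sqnorm y)^-1 by rewrite /r exprVn sqr_sqrtr ?sqnorm_ge0.
have x1 : sqnorm (r%:C *: y) = 1 by rewrite sqnormZ r2 mulVf.
have quadZ : (r%:C *: y) ^t* *m A *m (r%:C *: y) = (r ^+ 2)%:C *: (y ^t* *m A *m y).
  have -> : (r%:C *: y) ^t* = r%:C *: y ^t*.
    apply/matrixP => i j; rewrite !mxE rmorphM; congr (_ * _).
    by apply: complex_ext; rewrite ?cRe_conj ?cIm_conj //= oppr0.
  by rewrite -!scalemxAl -scalemxAr scalerA -rmorphM.
have := lb (cRe (((r%:C *: y) ^t* *m A *m (r%:C *: y)) 0 0)).
rewrite quadZ mxE cRe_realM r2 => le.
rewrite -ler_pdivlMr // mulrC; apply: le.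
exists ((r ^+ 2)%:C * (y ^t* *m A *m y) 0 0); last by rewrite cRe_realM r2.
exists (r%:C *: y); first exact: norm2_sqnorm1.
by rewrite quadZ [RHS]mxE.
Qed.

(** Test [A] on [V *m y], which has the norm of [y]. This covers the Hessenberg matrices of all
    cycles. *)
Lemma accretive_compress n m (A : 'M[C]_n) (V : 'M[C]_(n, m)) (nu : R) :
  accretive A nu -> V ^t* *m V = 1%:M -> accretive (V ^t* *m A *m V) nu.
Proof.
move=> acc VV y; have := acc (V *m y).
rewrite /sqnorm adjointM.
have -> : y ^t* *m V ^t* *m (V *m y) = y ^t* *m y.
  by rewrite mulmxA -(mulmxA _ _ V) VV mulmx1.
by rewrite !mulmxA.
Qed.

End NumericalRange.

(** * Exponential weights and their inheritance by the restart functions *)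

Section WeightedIntegrability.
Variable R : realType.
Notation mu := (@lebesgue_measure R).
Notation C := R[i].
Implicit Types (f : R -> C) (s nu : R).

Definition wintegrable f s := cintegrable (fun t => (expR (- s * t))%:C * f t).

Lemma abs_conv_region_real f s : abs_conv_region f s%:C <-> wintegrable f s.
Proof.
have cexpE t : f t * cexp (- s%:C * t%:C) = (expR (- s * t))%:C * f t.
  rewrite mulrC /cexp (_ : - s%:C * t%:C = (- s * t)%:C); last first.
    by rewrite rmorphM rmorphN.
  by rewrite /= cos0 sin0 mulr1.
by split; apply: cintegrable_ext => t _; rewrite cexpE.
Qed.

Lemma cmeasurable_expR s : cmeasurable (fun t => (expR (s * t))%:C).
Proof. by apply: cmeasurable_real; exact: measurable_expRM. Qed.

Lemma wintegrable_cmeasurable f s : wintegrable f s -> cmeasurable f.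
Proof.
move=> /cintegrable_cmeasurable mf.
apply: (cmeasurable_ext _ (cmeasurableM (cmeasurable_expR s) mf)) => t _.
by rewrite mulrA -rmorphM -expRD mulNr subrr expR0 mul1r.
Qed.

Lemma wintegrable_le f s s' : s <= s' -> wintegrable f s -> wintegrable f s'.
Proof.
move=> ss' wf; apply: (cintegrable_nrm_le _ wf).
  by apply: cmeasurableM; [exact: cmeasurable_expR|exact: wintegrable_cmeasurable wf].
move=> t t0; rewrite !nrm_realM !ger0_norm ?expR_ge0 // ler_wpM2r ?nrm_ge0 //.
by rewrite ler_expR ler_wpM2r // lerN2.
Qed.

Lemma cmeasurable_flow n (M : 'M[C]_n) i j : cmeasurable (fun t => mxflow M t i j).
Proof.
apply: ccontinuous_cmeasurable; apply: is_cderive_continuous => t.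
exact: mxflow_derive.
Qed.

Lemma laplace_mx_cvg_wintegrable f n (M : 'M[C]_n) nu :
  accretive M nu -> wintegrable f nu -> laplace_mx_cvg f M.
Proof.
move=> acc wf i j; apply: (cintegrable_nrm_le _ (cintegrableZ 2%:C wf)).
  by apply: cmeasurableM; [exact: wintegrable_cmeasurable wf|exact: cmeasurable_flow].
move=> t t0; apply: (le_trans (nrmM _ _)).
rewrite mulrA -rmorphM nrm_realM ger0_norm ?mulr_ge0 ?expR_ge0 // mulrC.
by rewrite ler_wpM2r ?nrm_ge0 // nrm_flow_le.
Qed.

(** The modulus is multiplicative, and [nrm] lies between the modulus and the square root of 2 times
    it. *)
Lemma nrmM_ge (z w : C) : nrm z * nrm w <= 2 * nrm (z * w).
Proof.
have sqr_le (u : C) : nrm u ^+ 2 <= 2 * (cRe u ^+ 2 + cIm u ^+ 2).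
  rewrite /nrm -(real_normK (num_real (cRe _))) -(real_normK (num_real (cIm _))).
  by move: (`|_|) (`|_|) => a b; have := sqr_ge0 (a - b); nra.
have sqr_ge (u : C) : cRe u ^+ 2 + cIm u ^+ 2 <= nrm u ^+ 2.
  rewrite /nrm -(real_normK (num_real (cRe _))) -(real_normK (num_real (cIm _))).
  by have := normr_ge0 (cRe u); have := normr_ge0 (cIm u); move: (`|_|) (`|_|) => a b; nra.
have modM : cRe (z * w) ^+ 2 + cIm (z * w) ^+ 2 =
    (cRe z ^+ 2 + cIm z ^+ 2) * (cRe w ^+ 2 + cIm w ^+ 2).
  by rewrite cReM cImM; ring.
rewrite -(@ler_pXn2r _ 2) ?nnegrE ?mulr_ge0 ?nrm_ge0 // !exprMn.
apply: (@le_trans _ _ (2 ^+ 2 * (cRe (z * w) ^+ 2 + cIm (z * w) ^+ 2))).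
  rewrite modM (_ : 2 ^+ 2 * _ = (2 * (cRe z ^+ 2 + cIm z ^+ 2)) *
                                 (2 * (cRe w ^+ 2 + cIm w ^+ 2))); last by ring.
  by apply: ler_pM; rewrite ?sqr_ge0.
by rewrite ler_pM2l ?exprn_gt0.
Qed.

Lemma integrable_sum_EFin I (r : seq I) (F : I -> R -> R) :
  (forall i, mu.-integrable (@half_line R) (EFin \o F i)) ->
  mu.-integrable (@half_line R) (EFin \o (fun t => \sum_(i <- r) F i t)).
Proof.
move=> iF.
have mhl : measurable (@half_line R : set (measurableTypeR R)) := @measurable_half_line R.
apply: eq_integrable (integrable_sum mhl r (fun i _ => iF i)) => // t _ /=.
by rewrite sumEFin.
Qed.

(** The weight is at most the sum of the norms of the entries of the flow, and by [nrmM_ge] each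
    product with [nrm (f t)] is controlled by an integrand of the Laplace transform. *)
Lemma wintegrable_flow_ge f n (M : 'M[C]_n) nu : cmeasurable f ->
  laplace_mx_cvg f M ->
  (forall t, 0 <= t -> expR (- nu * t) <= mxnrm (mxflow M t)) ->
  wintegrable f nu.
Proof.
move=> mf cvgf ge.
have mhl : measurable (@half_line R : set (measurableTypeR R)) := @measurable_half_line R.
apply: (cintegrable_le (phi := fun t => \sum_i \sum_j 2 * nrm (f t * mxflow M t i j))).
- by apply: cmeasurableM => //; exact: cmeasurable_expR.
- apply: integrable_sum_EFin => i; apply: integrable_sum_EFin => j.
  exact: (integrableZl mhl 2 (integrable_nrm (cvgf i j))).
- move=> t t0; rewrite nrm_realM ger0_norm ?expR_ge0 //.
  apply: (@le_trans _ _ (mxnrm (mxflow M t) * nrm (f t))).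
    by rewrite ler_wpM2r ?nrm_ge0 ?ge.
  rewrite mulr_suml; apply: ler_sum => i _; rewrite mulr_suml; apply: ler_sum => j _.
  by rewrite mulrC nrmM_ge.
Qed.

(* When [nu] is on the boundary of the region of absolute convergence, the
   restart functions need not be integrable against [expR (- nu * t)], but this
   weaker property is inherited by all of them. *)
Definition wintegrable_right f nu := forall s, nu < s -> wintegrable f s.

(** If one of the flows is bounded below by [expR (- nu * t)], convergence of its Laplace transform
    allows [gamma = nu]. Otherwise both decay faster, and [gamma] is the smaller of the two
    rates. *)
Lemma common_decay f n m (A : 'M[C]_n) (H : 'M[C]_m) nu :
  accretive A nu -> accretive H nu -> wintegrable_right f nu ->
  laplace_mx_cvg f A -> laplace_mx_cvg f H ->
  exists gamma B, [/\ wintegrable f gamma,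
    forall t, 0 <= t -> mxnrm (mxflow A t) <= B * expR (- gamma * t) &
    forall t, 0 <= t -> mxnrm (mxflow H t) <= B * expR (- gamma * t)].
Proof.
move=> accA accH wf cA cH.
have mf : cmeasurable f.
  by apply: (wintegrable_cmeasurable (s := nu + 1)); apply: wf; rewrite ltrDl.
have weaken (p : nat) (M : 'M[C]_p) g g' B B' : 0 <= B' -> B <= B' -> g <= g' ->
    (forall t, 0 <= t -> mxnrm (mxflow M t) <= B * expR (- g' * t)) ->
    forall t, 0 <= t -> mxnrm (mxflow M t) <= B' * expR (- g * t).
  move=> B0 BB gg h t t0; apply: (le_trans (h t t0)).
  apply: (@le_trans _ _ (B' * expR (- g' * t))); first by rewrite ler_wpM2r ?expR_ge0.
  by rewrite ler_wpM2l // ler_expR ler_wpM2r // lerN2.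
have common (g gA gH BA BH : R) : g <= gA -> g <= gH -> 0 <= BA -> 0 <= BH ->
    wintegrable f g ->
    (forall t, 0 <= t -> mxnrm (mxflow A t) <= BA * expR (- gA * t)) ->
    (forall t, 0 <= t -> mxnrm (mxflow H t) <= BH * expR (- gH * t)) ->
    exists gamma B, [/\ wintegrable f gamma,
      forall t, 0 <= t -> mxnrm (mxflow A t) <= B * expR (- gamma * t) &
      forall t, 0 <= t -> mxnrm (mxflow H t) <= B * expR (- gamma * t)].
  move=> gA1 gH1 BA0 BH0 wg hA hH; exists g, (BA + BH); split => //.
  - by apply: weaken hA; rewrite ?addr_ge0 ?lerDl.
  - by apply: weaken hH; rewrite ?addr_ge0 ?lerDr.
have slow : wintegrable f nu -> exists gamma B, [/\ wintegrable f gamma,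
      forall t, 0 <= t -> mxnrm (mxflow A t) <= B * expR (- gamma * t) &
      forall t, 0 <= t -> mxnrm (mxflow H t) <= B * expR (- gamma * t)].
  have [BA BA0 hA] := mxnrm_flow_le accA; have [BH BH0 hH] := mxnrm_flow_le accH.
  by move=> wnu; apply: (common nu nu nu BA BH).
have [geA|[gA nugA [BA BA0 hA]]] := mxnrm_flow_dichotomy accA.
  exact/slow/(wintegrable_flow_ge mf cA).
have [geH|[gH nugH [BH BH0 hH]]] := mxnrm_flow_dichotomy accH.
  exact/slow/(wintegrable_flow_ge mf cH).
apply: (common (Num.min gA gH) gA gH BA BH) => //.
- by rewrite ge_min lexx.
- by rewrite ge_min lexx orbT.
- by apply: wf; rewrite lt_min nugA.
Qed.

Section restart.
Variables (f : R -> C) (m : nat) (H : 'M[C]_m) (i j : 'I_m) (nu : R).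
Hypothesis accH : accretive H nu.
Let f2 t := cintegral (fun x => f (t + x) * mxflow H x i j).

(** The kernel decays at the rate [nu > s], so the weight passes on without loss. *)
Lemma conv_wintegrable s : s < nu -> wintegrable f s -> wintegrable f2 s.
Proof.
move=> snu wf; apply: (conv_cintegrable (c := nu) (a := s) (B := 2)).
- exact: wintegrable_cmeasurable wf.
- exact: cmeasurable_flow.
- exact: wf.
- by move=> t t0; exact: nrm_flow_le.
- exact: lexx.
- exact: ltW.
- by rewrite snu orbT.
Qed.

(** By the dichotomy for the flow of [H], either [f] is integrable with weight [nu] itself, and
    [nu < s] is the strict inequality required, or the kernel decays at a rate [g > nu]. *)
Lemma conv_wintegrable_right : wintegrable_right f nu -> laplace_mx_cvg f H ->
  wintegrable_right f2 nu.
Proof.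
move=> wf cH s nus.
have mf : cmeasurable f.
  by apply: (wintegrable_cmeasurable (s := nu + 1)); apply: wf; rewrite ltrDl.
have [geH|[g nug [B B0 hH]]] := mxnrm_flow_dichotomy accH.
  apply: (conv_cintegrable (c := nu) (a := nu) (B := 2)) => //.
  - exact: cmeasurable_flow.
  - exact: (wintegrable_flow_ge mf cH).
  - by move=> t t0; exact: nrm_flow_le.
  - exact: ltW.
  - by rewrite nus.
(* A weight above [nu], at most [s] and strictly below the decay rate [g]. *)
pose a := Num.min s ((nu + g) / 2).
have ag : a < g by rewrite gt_min; apply/orP; right; lra.
have nua : nu < a by rewrite lt_min nus /=; lra.
apply: (conv_cintegrable (c := g) (a := a) (B := B)) => //.
- exact: cmeasurable_flow.
- exact: wf.
- by move=> t t0; apply: le_trans (hH t t0); exact: nrm_le_mxnrm.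
- by rewrite ge_min lexx.
- exact: ltW.
- by rewrite ag orbT.
Qed.

End restart.
End WeightedIntegrability.

(** * The error of one cycle *)

Section ArnoldiError.
Variable R : realType.
Notation mu := (@lebesgue_measure R).
Notation C := R[i].

Lemma mulmx_entry m n p (X : 'M[C]_(m, n)) (Y : 'M[C]_(n, p)) i j :
  (X *m Y) i j = \sum_k X i k * Y k j.
Proof. by rewrite mxE. Qed.

Lemma laplace_mulmx (f : R -> C) n p (M : 'M[C]_n) (P : 'M[C]_(n, p)) i j :
  laplace_mx_cvg f M ->
  cintegrable (fun t => f t * (mxflow M t *m P) i j) /\
  (laplace_mx f M *m P) i j = cintegral (fun t => f t * (mxflow M t *m P) i j).
Proof.
move=> cM.
have E t : \sum_k P k j * (f t * mxflow M t i k) = f t * (mxflow M t *m P) i j.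
  by rewrite mxE mulr_sumr; apply: eq_bigr => k _; rewrite mulrC mulrA.
have iE k : cintegrable (fun t => P k j * (f t * mxflow M t i k)).
  exact/cintegrableZ/cM.
split; first by apply: cintegrable_ext (cintegrable_sum _ iE) => t _; exact: E.
rewrite mxE; transitivity (\sum_k cintegral (fun t => P k j * (f t * mxflow M t i k))).
  by apply: eq_bigr => k _; rewrite cintegralZ ?mxE 1?mulrC //; exact: cM.
by rewrite -cintegral_sum //; apply: cintegral_ext => t _; rewrite E.
Qed.

Lemma mulmx_laplace (f : R -> C) n p (M : 'M[C]_n) (P : 'M[C]_(p, n)) i j :
  laplace_mx_cvg f M ->
  cintegrable (fun t => f t * (P *m mxflow M t) i j) /\
  (P *m laplace_mx f M) i j = cintegral (fun t => f t * (P *m mxflow M t) i j).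
Proof.
move=> cM.
have E t : \sum_k P i k * (f t * mxflow M t k j) = f t * (P *m mxflow M t) i j.
  by rewrite mxE mulr_sumr; apply: eq_bigr => k _; rewrite mulrCA.
have iE k : cintegrable (fun t => P i k * (f t * mxflow M t k j)).
  exact/cintegrableZ/cM.
split; first by apply: cintegrable_ext (cintegrable_sum _ iE) => t _; exact: E.
rewrite mxE; transitivity (\sum_k cintegral (fun t => P i k * (f t * mxflow M t k j))).
  by apply: eq_bigr => k _; rewrite cintegralZ ?mxE //; exact: cM.
by rewrite -cintegral_sum //; apply: cintegral_ext => t _; rewrite E.
Qed.

Lemma ccvg_near (s : nat -> C) (l : C) N : (forall n, (N <= n)%N -> s n = l) -> ccvg s l.
Proof.
move=> sl; split; apply: cvg_near_cst; exists N => // k /= Nk; by rewrite sl.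
Qed.

Lemma ler_nat_truncn (t : R) n : 0 <= t -> ((Num.truncn t).+1 <= n)%N -> t <= n%:R.
Proof.
move=> t0 tn; have /andP[_ /ltW lt] := truncn_itv t0.
by apply: (le_trans lt); rewrite ler_nat.
Qed.

Lemma truncated_cintegral (w : R -> C) : cintegrable w ->
  ccvg (fun N => cintegral (fun t => ((t <= N%:R)%R%:R : R)%:C * w t)) (cintegral w).
Proof.
move=> iw; apply: (dominated_cintegral (u_ := fun N t => ((t <= N%:R)%R%:R : R)%:C * w t)
  (g := fun t => nrm (w t))).
- move=> N; apply: cmeasurableM; last exact: cintegrable_cmeasurable.
  apply: cmeasurable_real; apply: measurable_funTS.
  exact: (measurable_leb (f := fun t => t) (g := fun=> N%:R)).
- exact: cintegrable_cmeasurable.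
- exact: integrable_nrm.
- move=> t t0; apply: (@ccvg_near _ _ (Num.truncn t).+1) => n tn.
  by rewrite (ler_nat_truncn t0 tn) /= mul1r.
- move=> N t t0; rewrite nrm_realM normr_nat /= ler_piMl ?nrm_ge0 //.
  by rewrite lern1 leq_b1.
Qed.

Section cycle.
Variables (n m : nat) (A : 'M[C]_n) (H : 'M[C]_m) (V : 'M[C]_(n, m)).
Variables (v : 'cV[C]_n) (e : 'I_m) (h : C) (j0 : 'I_m).
Hypothesis relation : A *m V = V *m H + h *: (v *m delta_mx 0 e).

(* [D s *m mxflow H s = mxflow A s *m V], whereas [D 0 *m mxflow H s] is
   [V *m mxflow H s]: the error of the cycle is the integral of [f s] times the
   increment of [D] over [0, s]. *)
Let D t := mxflow A t *m V *m mxflow H (0 - t).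
Let D' t : 'M[C]_(n, m) := (- h) *: (mxflow A t *m v *m (delta_mx 0 e *m mxflow H (0 - t))).

(** The product rule leaves [V *m H - A *m V] between the two flows, which by the Arnoldi relation
    is the rank-one term. The argument is written [0 - t] to fit [mxflow_mxderive_subl]. *)
Let D_derive t : is_mxderive D t (D' t).
Proof.
have -> : D' t = (- (A *m mxflow A t) *m V) *m mxflow H (0 - t) +
                 mxflow A t *m V *m (H *m mxflow H (0 - t)).
  have AV : mxflow A t *m A *m V =
      mxflow A t *m V *m H + h *: (mxflow A t *m v *m delta_mx 0 e).
    by rewrite -(mulmxA _ A V) relation mulmxDr -scalemxAr !mulmxA.
  rewrite mulNmx mxflow_comm AV mulNmx mulmxDl opprD -scalemxAl -scaleNr.
  by rewrite [X in _ = _ + X]mulmxA addrAC addNr add0r /D' mulmxA.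
apply: is_mxderiveM; last exact: mxflow_mxderive_subl.
by apply: is_mxderive_mulmxr; exact: mxflow_mxderive.
Qed.

Let D0 : D 0 = V.
Proof. by rewrite /D subr0 !mxflow0 mul1mx mulmx1. Qed.

Let D_flow s u : D u *m mxflow H s = mxflow A u *m V *m mxflow H (s - u).
Proof. by rewrite /D -mulmxA -mxflowD; congr (_ *m mxflow H _); ring. Qed.

Variables (f : R -> C) (gamma B : R).
Hypothesis wf : wintegrable f gamma.
Hypothesis hA : forall t, 0 <= t -> mxnrm (mxflow A t) <= B * expR (- gamma * t).
Hypothesis hH : forall t, 0 <= t -> mxnrm (mxflow H t) <= B * expR (- gamma * t).
Hypotheses (cA : laplace_mx_cvg f A) (cH : laplace_mx_cvg f H).
(** The next restart function, once [e] is the last index and [j0] the first. *)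
Let f2 t := cintegral (fun x => f (t + x) * mxflow H x e j0).
Hypothesis c2 : laplace_mx_cvg f2 A.

Let kappa l s := f s * mxflow H s l j0.
Let K l t := cintegral (fun s => ((t <= s)%R%:R : R)%:C * kappa l s).

Let ikappa l : cintegrable (kappa l). Proof. exact: cH. Qed.

(** The semigroup law at [x = (0 - t) + (t + x)] separates [t] from the integration variable
    [t + x]. *)
Let f2E t : 0 <= t -> f2 t = \sum_l mxflow H (0 - t) e l * K l t.
Proof.
move=> t0.
have iS l : cintegrable (fun x => mxflow H (0 - t) e l * kappa l (t + x)).
  exact/cintegrableZ/(cintegrable_shift t0 (ikappa l)).
transitivity (\sum_l cintegral (fun x => mxflow H (0 - t) e l * kappa l (t + x))).
  rewrite -cintegral_sum //; apply: cintegral_ext => x _.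
  have -> : x = 0 - t + (t + x) by ring.
  rewrite mxflowD mxE mulr_sumr.
  have -> : 0 - t + (t + x) = x by ring.
  by apply: eq_bigr => l _; rewrite /kappa mulrCA.
apply: eq_bigr => l _; rewrite cintegralZ; last exact: cintegrable_shift.
by rewrite (cintegral_shift t0) //; exact: cintegrable_cmeasurable.
Qed.

Let cD' i l : ccontinuous (fun t => D' t i l).
Proof.
pose D'' t : 'M[C]_(n, m) := (- h) *:
  ((- (A *m mxflow A t) *m v) *m (delta_mx 0 e *m mxflow H (0 - t)) +
   (mxflow A t *m v) *m (delta_mx 0 e *m (H *m mxflow H (0 - t)))).
apply: (@is_cderive_continuous _ _ (fun t => D'' t i l)) => t.
have : is_mxderive D' t (D'' t); last exact.
rewrite /D' /D'' -[(- h) *: (_ + _)]mul_scalar_mx.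
under [X in is_mxderive X]eq_fun do rewrite -mul_scalar_mx.
apply: is_mxderive_mulmxl; apply: is_mxderiveM.
  by apply: is_mxderive_mulmxr; exact: mxflow_mxderive.
by apply: is_mxderive_mulmxl; exact: mxflow_mxderive_subl.
Qed.

(** The integrand produced by the Fubini exchange on [[0, N]]; its pointwise limit in [N] is [u]
    below. *)
Let U N s i := \sum_l (D (Num.min s N%:R) i l - D 0 i l) * kappa l s.

Let UE N s i : U N s i =
  f s * ((D (Num.min s N%:R) *m mxflow H s - V *m mxflow H s) i j0).
Proof.
rewrite /U; set X := D _.
have -> : X *m mxflow H s - V *m mxflow H s = (X - V) *m mxflow H s.
  by rewrite mulmxBl.
clearbody X; rewrite D0 mulmx_entry mulr_sumr; apply: eq_bigr => l _.
by rewrite /kappa mulrCA [(X - V) i l]mxE [(- V) i l]mxE.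
Qed.

Let iU N i : cintegrable (fun s => U N s i).
Proof.
apply: cintegrable_sum => l.
apply: (cintegrable_fubini_head (d := fun t => D t i l) (d' := fun t => D' t i l)) => //.
by move=> t; exact: D_derive.
Qed.

Let u s i := f s * ((mxflow A s *m V - V *m mxflow H s) i j0).

Let iu i : cintegrable (u^~ i).
Proof.
have [i1 _] := laplace_mulmx V i j0 cA; have [i2 _] := mulmx_laplace V i j0 cH.
apply: cintegrable_ext (cintegrableD i1 (cintegrableZ (-1) i2)) => s _.
by rewrite /u !mxE; ring.
Qed.

(** By [f2E], the sum over [l] of [D' t i l * K l t] is [- h * f2 t] times an entry of
    [mxflow A t *m v]; the Fubini exchange is applied to each [l]. *)
Let truncated i N :
  cintegral (fun t => ((t <= N%:R)%R%:R : R)%:C * (h * (f2 t * (mxflow A t *m v) i 0))) =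
  - cintegral (fun s => U N s i).
Proof.
have N0 : 0 <= N%:R :> R by [].
have dD l t : is_cderive (fun t => D t i l) t (D' t i l) by exact: D_derive.
have iT l : cintegrable (fun t => ((t <= N%:R)%R%:R : R)%:C * (D' t i l * K l t)).
  exact: (cintegrable_fubini_tail N%:R (cD' i l) (ikappa l)).
have iH l : cintegrable (fun s => (D (Num.min s N%:R) i l - D 0 i l) * kappa l s).
  exact: (cintegrable_fubini_head N0 (dD l) (cD' i l) (ikappa l)).
rewrite -mulN1r [in RHS]/U cintegral_sum //.
under eq_bigr => l _ do
  rewrite -(cintegral_fubini_tail N0 (dD l) (cD' i l) (ikappa l)).
rewrite -cintegral_sum // -cintegralZ; last exact: cintegrable_sum.
apply: cintegral_ext => t t0; rewrite (f2E t0) -mulr_sumr [RHS]mulrCA; congr (_ * _).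
rewrite mulr_suml !mulr_sumr; apply: eq_bigr => l _.
have -> : D' t i l = - h * ((mxflow A t *m v) i 0 * mxflow H (0 - t) e l).
  rewrite mxE; congr (_ * _); rewrite mxE big_ord1; congr (_ * _).
  by rewrite -rowE mxE.
by rewrite /K; ring.
Qed.

Lemma arnoldi_laplace_error :
  laplace_mx f A *m col j0 V - V *m col j0 (laplace_mx f H) =
  - h *: (laplace_mx f2 A *m v).
Proof.
apply/matrixP => i j; rewrite (ord1 j) {j}.
have [i1 e1] := laplace_mulmx V i j0 cA; have [i2 e2] := mulmx_laplace V i j0 cH.
have [i3 e3] := laplace_mulmx v i 0 c2.
have -> : (laplace_mx f A *m col j0 V - V *m col j0 (laplace_mx f H)) i 0 =
    cintegral (u^~ i).
  have colM p q r (X : 'M[C]_(p, q)) (Y : 'M[C]_(q, r)) k l :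
      (X *m col l Y) k 0 = (X *m Y) k l.
    by rewrite !mulmx_entry; apply: eq_bigr => x _; rewrite mxE.
  rewrite mxE [X in _ + X]mxE !colM e1 e2 -mulN1r -cintegralZ // -cintegralD //; last first.
    exact: cintegrableZ.
  by apply: cintegral_ext => s _; rewrite /u [in RHS]mxE [X in _ = _ * (_ + X)]mxE; ring.
rewrite mxE e3 mulNr -cintegralZ //; apply/eqP; rewrite -eqr_oppLR; apply/eqP.
(* The truncated integrals tend to the integral over the half line, and by [truncated] also to minus
   the integral of [u]; limits are unique. *)
have cT := truncated_cintegral (cintegrableZ h i3).
apply: ccvg_unique cT.
apply: (@ccvg_ext _ (fun N => - 1 * cintegral (fun s => U N s i))).
  by move=> N; rewrite truncated mulN1r.
rewrite -[X in ccvg _ X]mulN1r; apply: (ccvgM (ccvg_cst _)).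
(* The first summand bounds [mxflow A r *m V *m mxflow H (s - r)], the second [V *m mxflow H s],
   both relative to [expR (- gamma * s)]. As [r] and [s - r] add up to [s], the bound is uniform in
   [N]. *)
pose c := B * mxnrm V * B + mxnrm V * B.
apply: (dominated_cintegral (u_ := fun N s => U N s i) (u := u^~ i)
  (g := fun s => c * nrm ((expR (- gamma * s))%:C * f s))).
- by move=> N; exact/cintegrable_cmeasurable/iU.
- exact/cintegrable_cmeasurable/iu.
- have mhl : measurable (@half_line R : set (measurableTypeR R)) := @measurable_half_line R.
  exact: (integrableZl mhl c (integrable_nrm wf)).
(* The sequence is eventually constant: for [N >= s] the minimum is [s], and [D s *m mxflow H s] is
   [mxflow A s *m V]. *)
- move=> s s0; apply: (@ccvg_near _ _ (Num.truncn s).+1) => N sN.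
  rewrite UE /u min_l ?(ler_nat_truncn s0 sN) //.
  by rewrite (D_flow s s) (subrr s) mxflow0 mulmx1.
move=> N s s0; rewrite UE; apply: (le_trans (nrmM _ _)).
rewrite nrm_realM ger0_norm ?expR_ge0 // mulrA mulrC ler_wpM2r ?nrm_ge0 //.
set r := Num.min s N%:R; have r0 : 0 <= r by rewrite le_min s0 /=.
have sr : 0 <= s - r by rewrite subr_ge0 ge_min lexx.
rewrite (D_flow s r) mxE [X in nrm (_ + X)]mxE;
apply: (le_trans (nrmD _ _)); rewrite nrmN mulrDl.
apply: lerD.
  apply: (le_trans (nrm_le_mxnrm _ _ _)).
  apply: (le_trans (mxnrmM _ _)).
  rewrite (_ : B * mxnrm V * B * _ =
      B * expR (- gamma * r) * mxnrm V * (B * expR (- gamma * (s - r)))); last first.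
    have -> : - gamma * s = - gamma * r + - gamma * (s - r) by ring.
    by rewrite expRD; ring.
  apply: ler_pM; rewrite ?mxnrm_ge0 ?hH //.
  by apply: (le_trans (mxnrmM _ _)); rewrite ler_wpM2r ?mxnrm_ge0 ?hA.
apply: (le_trans (nrm_le_mxnrm _ _ _)); apply: (le_trans (mxnrmM _ _)).
by rewrite -mulrA ler_wpM2l ?mxnrm_ge0 ?hH.
Qed.

End cycle.
End ArnoldiError.

(** * From one cycle to all cycles *)

Lemma norm2_eq0 (R : realType) n (y : 'cV[R[i]]_n) : norm2 y = 0 -> y = 0.
Proof.
move/eqP; rewrite /norm2 sqrtC_eq0 psumr_eq0 => [/allP y0|i _]; last exact: exprn_ge0.
apply/matrixP => i j; rewrite (ord1 j) mxE.
by have := y0 i (mem_index_enum _); rewrite expf_eq0 /= normr_eq0 => /eqP.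
Qed.

Lemma restart_funS (R : realType) m (f : R -> R[i]) (H : nat -> 'M[R[i]]_m.+1) j :
  restart_fun f H j.+2 = fun t => cintegral (fun x =>
    restart_fun f H j.+1 (t + x) * mxflow (H j.+1) x ord_max ord0).
Proof.
apply/funext => t /=; apply: cintegral_ext => x _; congr (_ * _).
by rewrite /restart_kernel /e_last /e_first trmx_delta -rowE -colE !mxE.
Qed.

Theorem corollary3p3 (R : realType) (n m : nat) (A : 'M[R[i]]_n)
    (b : 'cV[R[i]]_n) (f : R -> R[i]) (nu : R)
    (V : nat -> 'M[R[i]]_(n, m.+1)) (H : nat -> 'M[R[i]]_m.+1)
    (h : nat -> R[i]) (v : nat -> 'cV[R[i]]_n) (k : nat)
    (hnu : is_min [set complex.Re mu | mu in field_of_values A] nu)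
    (hconv : abs_conv_region f nu%:C)
    (hk : (1 <= k)%N)
    (harnoldi : restarted_arnoldi A b V H h v k) :
  ((exists2 sigma : R, sigma < nu & abs_conv_region f sigma%:C) ->
    restart_well_defined f A H k)
  /\
  (restart_well_defined f A H k ->
    laplace_mx f A *m b - iterate f b V H h k =
    ((-1) ^+ k * (\prod_(1 <= j < k.+1) h j) * norm2 b) *:
      (laplace_mx (restart_fun f H k.+1) A *m v k)).
Proof.
have accA := accretive_field_of_values hnu.
have accH j : (1 <= j <= k)%N -> accretive (H j) nu.
  move=> jk; have [_ VV _ _ _ _ -> _ _ _] := harnoldi _ jk.
  exact: accretive_compress.
have wnu : wintegrable f nu by exact/abs_conv_region_real.
split => [[sigma lt_sigma /abs_conv_region_real wsigma]|[cH cA]].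
  (* The weight [sigma] passes from each restart function to the next, since the kernels decay at
     the rate [nu > sigma]. *)
  have w j : (j <= k)%N -> wintegrable (restart_fun f H j.+1) sigma.
    elim: j => [//|j ih jk]; rewrite restart_funS.
    exact: (conv_wintegrable ord_max ord0 (accH j.+1 jk) lt_sigma (ih (ltnW jk))).
  split=> -[//|j] /andP[_ jk].
    apply: (laplace_mx_cvg_wintegrable (nu := nu)); first exact: accH.
    exact: (wintegrable_le (ltW lt_sigma) (w _ (ltnW jk))).
  apply: (laplace_mx_cvg_wintegrable accA).
  exact: (wintegrable_le (ltW lt_sigma) (w _ jk)).
(* [restart_well_defined] starts at index 2; the integrals for index 1 exist by [wnu]. *)
have cH' j : (1 <= j <= k)%N -> laplace_mx_cvg (restart_fun f H j) (H j).
  case: j => [//|[|j]] jk; last exact: cH.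
  exact: laplace_mx_cvg_wintegrable (accH _ jk) wnu.
have cA' j : (1 <= j <= k.+1)%N -> laplace_mx_cvg (restart_fun f H j) A.
  case: j => [//|[|j]] jk; last exact: cA.
  exact: laplace_mx_cvg_wintegrable accA wnu.
(* Only weights strictly above [nu] are inherited here, as [nu] may lie on the boundary of the
   region. *)
have w j : (j <= k)%N -> wintegrable_right (restart_fun f H j.+1) nu.
  elim: j => [_ s /ltW nus|j ih jk]; first exact: wintegrable_le nus wnu.
  rewrite restart_funS.
  exact: (conv_wintegrable_right ord_max ord0 (accH j.+1 jk) (ih (ltnW jk)) (cH' j.+1 jk)).
have step j : (j < k)%N ->
    laplace_mx (restart_fun f H j.+1) A *m col ord0 (V j.+1) -
      V j.+1 *m col ord0 (laplace_mx (restart_fun f H j.+1) (H j.+1)) =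
    - h j.+1 *: (laplace_mx (restart_fun f H j.+2) A *m v j.+1).
  move=> jk; have jk' : (1 <= j.+1 <= k)%N by [].
  have [_ _ _ _ _ _ _ _ _ rel] := harnoldi _ jk'.
  rewrite /e_last trmx_delta in rel.
  have cAj : laplace_mx_cvg (restart_fun f H j.+1) A by apply: cA'; exact: ltnW.
  have [g [B [wg hA hH]]] :=
    common_decay accA (accH _ jk') (w _ (ltnW jk)) cAj (cH' _ jk').
  have c2 : laplace_mx_cvg (restart_fun f H j.+2) A by exact: cA'.
  rewrite restart_funS in c2 *.
  exact: (arnoldi_laplace_error rel wg hA hH cAj (cH' _ jk') c2).
(* Here [j] stands for cycle [j.+1]. In the induction the old error and the correction carry the
   same scalar, so their difference is a multiple of a one-cycle error, to which [step] applies. *)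
have main j : (j < k)%N -> laplace_mx f A *m b - iterate f b V H h j.+1 =
    ((-1) ^+ j.+1 * (\prod_(1 <= i < j.+2) h i) * norm2 b) *:
      (laplace_mx (restart_fun f H j.+2) A *m v j.+1).
  elim: j => [|j ih] jk.
    have [b0 _ _ first _ _ _ _ _ _] := harnoldi 1%N jk.
    have nb0 : norm2 b != 0 by apply: contraNN b0 => /eqP /norm2_eq0 ->.
    rewrite [iterate _ _ _ _ _ _]/=.
    have {1}-> : b = norm2 b *: col ord0 (V 1%N).
      by rewrite first scalerA mulfV // scale1r.
    have s1 := step 0%N jk; rewrite [restart_fun f H 1]/= in s1.
    rewrite -scalemxAr -mulmxA /e_first -colE -scalerBr s1 scalerA.
    by congr (_ *: _); rewrite big_nat1 expr1; ring.
  have [_ _ _ _ unit _ _ _ _ _] := harnoldi j.+1 (ltnW jk).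
  have [_ _ _ first _ _ _ _ _ _] := harnoldi j.+2 jk.
  (* Later cycles start from a unit vector, so [norm2 b] enters in cycle 1 only. *)
  rewrite /cycle_start /= unit invr1 scale1r in first.
  change (iterate f b V H h j.+2) with
    (iterate f b V H h j.+1 + correction f b V H h j.+1).
  rewrite opprD addrA ih; last exact: ltnW.
  rewrite /correction -scalerBr -mulmxA /e_first -colE -first step // scalerA.
  by congr (_ *: _); rewrite (big_nat_recr j.+2) //= [in RHS]exprS; ring.
by case: k hk main {harnoldi accH cH cA cH' cA' w step} => // k _; apply.
Qed.
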